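(* Let $n=2l$ with $l\ge 1$. (Direct problem.) Let $b_0,\dots,b_{n-1}\in\mathbb{R}\setminus\{0\}$ and let $J_n$ be the Schwarz matrix with entries $b_0,\dots,b_{n-1}$. The characteristic polynomial $p(z)=\det(zE_n-J_n)$ is almost generalized Hurwitz of type I if and only if $$b_0b_1>0,\quad b_2b_3>0,\quad b_4b_5>0,\ \dots,\ b_{n-2}b_{n-1}>0$$ (that is, $b_{2j}b_{2j+1}>0$ for $0\le j\le l-1$). In this case the order $\varkappa$ of $p$ (as an almost generalized Hurwitz polynomial) equals the number of negative terms in the sequence $$b_0,\quad b_0b_1b_2,\quad b_0b_1b_2b_3b_4,\ \dots,\ b_0b_1\cdots b_{n-2}$$ (the products $\prod_{k=0}^{2i}b_k$, $i=0,\dots,l-1$). (Inverse problem.) Conversely, let $\lambda_1,\dots,\lambda_n$ be complex numbers such that the polynomial $p(z)=\prod_{k=1}^n(z-\lambda_k)$ is almost generalized Hurwitz of type I of order $\varkappa$ and $\Delta_j(p)\ne 0$ for $j=1,\dots,n$. Then there exists a unique Schwarz matrix $J_n$ with nonzero real entries $b_0,\dots,b_{n-1}$ satisfying $b_0b_1>0$, $b_2b_3>0$, $\dots$, $b_{n-2}b_{n-1}>0$, such that the number of negative terms in the sequence $b_0,\ b_0b_1b_2,\ \dots,\ b_0b_1\cdots b_{n-2}$ equals $\varkappa$, and $\sigma(J_n)=\{\lambda_1,\dots,\lambda_n\}$ (spectrum counted with multiplicities).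
   Context: The Schwarz matrix $J_n$ with entries $b_0,\dots,b_{n-1}\in\mathbb{R}\setminus\{0\}$ is the $n\times n$ tridiagonal matrix with $(1,1)$ entry $-b_0$, all other diagonal entries $0$, all superdiagonal entries $1$, and $(k+1,k)$ entry $-b_k$ for $1\le k\le n-1$. $E_n$ is the $n\times n$ identity matrix. Hurwitz determinants: for a monic real polynomial $p(z)=z^n+a_1z^{n-1}+\cdots+a_n$ put $a_0=1$ and $a_i=0$ for $i<0$ or $i>n$; then $\Delta_j(p)=\det\left[a_{2s-r}\right]_{r,s=1}^{j}$ ($r$ the row index, $s$ the column index), $j=1,\dots,n$. $[\alpha]$ is the largest integer not exceeding $\alpha$. Generalized Hurwitz polynomials: a real polynomial $f$ of degree $N$ is generalized Hurwitz of type I of order $\varkappa$, $1\le\varkappa\le\left[\frac{N+1}{2}\right]$, if it has exactly $\varkappa$ zeroes in the closed right half-plane, all of which are nonnegative and simple, $0\le\mu_1<\mu_2<\dots<\mu_\varkappa$, such that: $f(-\mu_i)\ne0$ for $i=2,\dots,\varkappa$, and $f(-\mu_1)\neq 0$ if $\mu_1>0$; $f$ has an odd number of zeroes, counting multiplicities, on each of the intervals $(-\mu_\varkappa,-\mu_{\varkappa-1}),\dots,(-\mu_3,-\mu_2),(-\mu_2,-\mu_1)$; the number of zeroes of $f$ on $(-\mu_1,0)$ (if any) is even, counting multiplicities; the other real zeroes lie on $(-\infty,-\mu_\varkappa)$, an odd number of them counting multiplicities if $N$ is even, and an even number if $N$ is odd; all nonreal zeroes (if any) lie in the open left half-plane.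 Almost generalized Hurwitz polynomials: a real polynomial $p(z)$ is almost generalized Hurwitz of type I of order $\varkappa\ge0$ if the polynomial $zp(z)$ is generalized Hurwitz of type I of order $\varkappa+1$; it is almost generalized Hurwitz of type I if it is so of some order. *)

(* Defs.v *)
From mathcomp Require Import all_boot all_order all_algebra.
From mathcomp Require Export complex polyrcf reals.

Set Implicit Arguments.
Unset Strict Implicit.
Unset Printing Implicit Defensive.

Import Order.TTheory GRing.Theory Num.Theory.
Local Open Scope ring_scope.
Local Open Scope complex_scope.

(* Indices are shifted by one: the (k+1, k) entry - b_k of the text is the
   entry of row k and column k - 1 here. *)
Definition schwarz_mx (R : nzRingType) n (b : n.-tuple R) : 'M[R]_n :=
  \matrix_(i, j)
    if (i == 0 :> nat) && (j == 0 :> nat) then - b`_0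
    else if j == i.+1 :> nat then 1
    else if i == j.+1 :> nat then - b`_i
    else 0.

(* The a_i of z^n + a_1 z^(n-1) + ... + a_n, with a_i = 0 for i outside [0, n]. *)
Definition hurwitz_coef (R : nzRingType) (p : {poly R}) (i : int) : R :=
  let n := (size p).-1 in
  if i is Posz k then if (k <= n)%N then p`_(n - k) else 0 else 0.

Definition hurwitz_det (R : comNzRingType) (p : {poly R}) (j : nat) : R :=
  \det (\matrix_(r < j, s < j)
          hurwitz_coef p (2 * (s.+1)%:Z - (r.+1)%:Z)).

(* Multiplicities are counted. *)
Definition nb_zeros (R : rcfType) (f : {poly R}) (I : interval R) : nat :=
  \sum_(x <- rootsR f | x \in I) mup x f.

(* mu = [:: mu_1; ...; mu_kappa], so that mu`_i is mu_(i+1).  The fields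
   together force every real zero of f outside mu and outside the bounded
   intervals below to lie on (-oo, - mu_kappa), hence the latter inclusion is
   not repeated. *)
Record genHurwitzI_at (R : rcfType) (f : {poly R}) (mu : seq R) : Prop := {
  ghI_order : (1 <= size mu <= ((size f).-1 + 1)./2)%N;
  ghI_ge0 : all (fun x => 0 <= x) mu;
  ghI_sorted : sorted <%R mu;
  ghI_simple : forall x, x \in mu -> mup x f = 1%N;
  ghI_closed_rhp : forall z : R[i],
    root (map_poly (real_complex R) f) z /\ 0 <= complex.Re z <->
    (exists2 x, x \in mu & z = x%:C);
  ghI_opp : forall i, (1 <= i < size mu)%N -> f.[- mu`_i] != 0;
  ghI_opp0 : 0 < mu`_0 -> f.[- mu`_0] != 0;
  ghI_between : forall i, (i.+1 < size mu)%N ->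
    odd (nb_zeros f `]- mu`_i.+1, - mu`_i[);
  ghI_near0 : ~~ odd (nb_zeros f `]- mu`_0, 0[);
  ghI_outer : odd (nb_zeros f `]-oo, - mu`_(size mu).-1[)
              = ~~ odd (size f).-1;
  ghI_nonreal : forall z : R[i],
    root (map_poly (real_complex R) f) z -> complex.Im z != 0 ->
    complex.Re z < 0
}.

Definition genHurwitzI (R : rcfType) (f : {poly R}) (kappa : nat) : Prop :=
  exists2 mu : seq R, size mu = kappa & genHurwitzI_at f mu.

Definition almost_genHurwitzI_order (R : rcfType) (p : {poly R})
    (kappa : nat) : Prop :=
  genHurwitzI ('X * p) kappa.+1.

Definition almost_genHurwitzI (R : rcfType) (p : {poly R}) : Prop :=
  exists kappa, almost_genHurwitzI_order p kappa.

Definition pairs_positive (R : numDomainType) l (b : (2 * l).-tuple R) : Prop :=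
  forall j, (j < l)%N -> 0 < b`_(2 * j) * b`_(2 * j).+1.

Definition nb_neg_products (R : numDomainType) l (b : (2 * l).-tuple R) : nat :=
  #|[set i : 'I_l | \prod_(0 <= k < (2 * i).+1) b`_k < 0]|.

(* The eigenvalues of J in the complex numbers, with their algebraic
   multiplicities, are the terms of lambda. *)
Definition has_spectrum (R : rcfType) n (J : 'M[R]_n) (lambda : n.-tuple R[i]) :
    Prop :=
  forall z : R[i],
    mup z (char_poly (map_mx (real_complex R) J)) = count_mem z lambda.

(* Main.v *)
(* With the b_k listed from the bottom row upwards as c_0, c_1, ..., the
   characteristic polynomial is p = s_n + c_(n-1) s_(n-1), where s_i has degree
   and parity i and s_(i+2) = X s_(i+1) + c_i s_i.  A Christoffel-Darboux
   argument gives
     (p(x)p(y) - p(-x)p(-y)) / (x + y) = sum_i d_i s_i(x) s_i(y)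
   with d_i = 2 c_i ... c_(n-1): for i even, all d_i > 0 iff the pairs
   b_(2j) b_(2j+1) are positive; for i odd, the d_i have the signs of the
   products b_0 ... b_(2j).  On the other hand, p is almost generalized Hurwitz
   iff its zeros mu_1 < ... < mu_k in the closed right half-plane are positive
   and p'(mu_i) p(-mu_i) > 0, by counting sign changes.
   Factoring p writes the left-hand side with at most k negative squares, so at
   most k of the d_i are negative.  At the points mu_i, the odd part of the
   kernel is negative definite (a Cauchy matrix plus a diagonal), so at least k
   of the d_i with i odd are negative.  Hence all even d_i are positive and
   exactly k odd ones are negative.  Conversely, if the even d_i are positive
   then the even part of the kernel at (z, conj z) is positive, which rules out
   nonreal zeros z in the closed right half-plane and, at a real zero, gives
   the sign of p'(z) p(-z).
   For the inverse problem the c_i are read off by the Routh scheme, whose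
   pivots are nonzero because the Hurwitz determinants are. *)
Require Import Defs.
From mathcomp Require Import all_boot all_order all_algebra.
From mathcomp Require Import zify ring lra.

Set Implicit Arguments.
Unset Strict Implicit.
Unset Printing Implicit Defensive.

Import Order.TTheory GRing.Theory Num.Theory.
Local Open Scope ring_scope.
Local Open Scope complex_scope.

(* The characteristic polynomial of the lower right m x m block of a Schwarz
   matrix whose subdiagonal entries are, from bottom to top, - c 0, - c 1, ... *)
Fixpoint schwarz_poly (R : nzRingType) (c : nat -> R) (m : nat) : {poly R} :=
  if m is m1.+1 then
    if m1 is m2.+1 then 'X * schwarz_poly c m1 + c m2 *: schwarz_poly c m2
    else 'X
  else 1.

Arguments schwarz_poly : simpl never.

(** The corner entry $-b_0$ turns the first diagonal entry of $zE_n-J_n$ into $z+c_{n-1}$; by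
    linearity in the first row this adds the second summand. *)
Definition schwarz_char (R : nzRingType) (c : nat -> R) (n : nat) : {poly R} :=
  schwarz_poly c n + c n.-1 *: schwarz_poly c n.-1.

(** * The recursive polynomials $s_i$ and their kernel *)

Section SchwarzPoly.
Variable R : fieldType.
Implicit Types (c : nat -> R) (x y : R).

Lemma schwarz_polySS c m :
  schwarz_poly c m.+2 = 'X * schwarz_poly c m.+1 + c m *: schwarz_poly c m.
Proof. by []. Qed.

Lemma eq_schwarz_poly c d m :
  (forall i, (i < m.-1)%N -> c i = d i) -> schwarz_poly c m = schwarz_poly d m.
Proof.
elim/ltn_ind: m => -[|[|m]] // IH cd.
rewrite !schwarz_polySS cd ?ltnSn //.
by rewrite !IH // => i /= im; apply: cd => /=; lia.
Qed.

Lemma size_schwarz_poly_monic c m :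
  size (schwarz_poly c m) = m.+1 /\ schwarz_poly c m \is monic.
Proof.
elim/ltn_ind: m => -[|[|m]] IH; first by rewrite size_poly1 monic1.
  by rewrite size_polyX monicX.
have [s1 m1] := IH m.+1 (ltnSn _); have [s0 _] := IH m (ltnW (ltnSn _)).
have sX : size ('X * schwarz_poly c m.+1) = m.+3.
  by rewrite mulrC size_mulX ?s1 // -size_poly_eq0 s1.
have lt_s : (size (c m *: schwarz_poly c m) <
             size ('X * schwarz_poly c m.+1)%R)%N.
  by rewrite sX; apply: leq_ltn_trans (size_scale_leq _ _) _; rewrite s0; lia.
rewrite schwarz_polySS size_polyDl // sX; split => //.
by rewrite monicE lead_coefDl // lead_coefM lead_coefX mul1r.
Qed.

Lemma size_schwarz_poly c m : size (schwarz_poly c m) = m.+1.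
Proof. by case: (size_schwarz_poly_monic c m). Qed.

Lemma schwarz_poly_monic c m : schwarz_poly c m \is monic.
Proof. by case: (size_schwarz_poly_monic c m). Qed.

Lemma horner_schwarz_polySS c m x :
  (schwarz_poly c m.+2).[x] =
    x * (schwarz_poly c m.+1).[x] + c m * (schwarz_poly c m).[x].
Proof. by rewrite schwarz_polySS !hornerE. Qed.

Lemma horner_schwarz_polyN c m x :
  (schwarz_poly c m).[- x] = (-1) ^+ m * (schwarz_poly c m).[x].
Proof.
elim/ltn_ind: m => -[|[|m]] IH; first by rewrite !hornerE.
  by rewrite !hornerE; ring.
by rewrite !horner_schwarz_polySS (IH m.+1) // (IH m) //; rewrite !exprS; ring.
Qed.

(* A Christoffel-Darboux identity. *)
Lemma schwarz_poly_kernel c m x y :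
  (schwarz_poly c m.+1).[x] * (schwarz_poly c m).[y] +
  (schwarz_poly c m).[x] * (schwarz_poly c m.+1).[y] =
  (x + y) * \sum_(i < m.+1) (\prod_(i <= j < m) c j) *
     (schwarz_poly c i).[x] * (schwarz_poly c i).[y].
Proof.
elim: m => [|m IH].
  rewrite big_ord_recr big_ord0 /= big_geq // (hornerX x) (hornerX y).
  by rewrite (hornerC 1 x) (hornerC 1 y); ring.
rewrite !horner_schwarz_polySS big_ord_recr /= big_geq //.
set S := \sum_(i < m.+1) _; set S' := \sum_(i < m.+1) _ in IH.
have -> : S = c m * S'.
  rewrite mulr_sumr; apply: eq_bigr => i _.
  by rewrite big_nat_recr ?leq_ord //=; ring.
rewrite (mulrDr (x + y)) (mulrCA (x + y)) -IH; ring.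
Qed.

(** For even $n$, parity gives $p(-x)=s_n(x)-c_{n-1}s_{n-1}(x)$. Only the cross terms
    $2c_{n-1}(s_n(x)s_{n-1}(y)+s_{n-1}(x)s_n(y))$ survive, and the previous identity applies to
    them. *)
Lemma schwarz_char_kernel c n x y : (0 < n)%N -> ~~ odd n ->
  (schwarz_char c n).[x] * (schwarz_char c n).[y] -
  (schwarz_char c n).[- x] * (schwarz_char c n).[- y] =
  (x + y) * \sum_(i < n) (2 * \prod_(i <= j < n) c j) *
     ((schwarz_poly c i).[x] * (schwarz_poly c i).[y]).
Proof.
case: n => // n _ /= /negbNE on; rewrite /schwarz_char /= !hornerD !hornerZ.
rewrite !horner_schwarz_polyN exprS -(signr_odd _ n) on expr1.
transitivity (2 * c n * ((schwarz_poly c n.+1).[x] * (schwarz_poly c n).[y] +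
  (schwarz_poly c n).[x] * (schwarz_poly c n.+1).[y])); first by ring.
rewrite schwarz_poly_kernel mulrCA mulr_sumr; congr (_ * _).
by apply: eq_bigr => i _; rewrite big_nat_recr ?leq_ord //=; ring.
Qed.

Lemma schwarz_char_monic c n : (0 < n)%N -> schwarz_char c n \is monic.
Proof.
case: n => // n _; rewrite monicE lead_coefDl.
  exact/eqP/monicP/schwarz_poly_monic.
rewrite size_schwarz_poly.
by apply: leq_ltn_trans (size_scale_leq _ _) _; rewrite size_schwarz_poly.
Qed.

End SchwarzPoly.

(** * Characteristic polynomials of Schwarz matrices *)

(** The signs are those of $zE_n-J_n$. Entries are functions on [nat], so that deleting the first
    row and column is a shift by [succn]. *)
Definition tridiag_mx (A : comNzRingType) (d e : nat -> A) m : 'M[A]_m :=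
  \matrix_(i, j)
    if i == j :> nat then d i
    else if j == i.+1 :> nat then -1
    else if i == j.+1 :> nat then e i
    else 0.

Lemma det_tridiag_mxSS (A : comNzRingType) (d e : nat -> A) m :
  \det (tridiag_mx d e m.+2) =
    d 0 * \det (tridiag_mx (d \o succn) (e \o succn) m.+1) +
    e 1%N * \det (tridiag_mx (d \o succn \o succn) (e \o succn \o succn) m).
Proof.
rewrite (expand_det_col _ ord0) 2!big_ord_recl big1 ?addr0; last first.
  by move=> i _; rewrite !mxE /= !mul0r.
rewrite !mxE /= /cofactor /= expr0 mul1r expr1 mulN1r; congr (_ * _ + _ * _).
  by congr (\det _); apply/matrixP => i j; rewrite !mxE.
rewrite (expand_det_row _ ord0) big_ord_recl big1 ?addr0; last first.
  by move=> i _; rewrite !mxE /= !mul0r.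
rewrite !mxE /= mulN1r opprK /cofactor expr0 mul1r.
congr (\det _); apply/matrixP => i j; rewrite !mxE /= /bump /=.
by rewrite !add1n !eqSS. 
Qed.

Lemma det_tridiag_mx_schwarz (R : fieldType) (c : nat -> R) m :
  \det (tridiag_mx (fun=> 'X) (fun i => (c (m - i.+1)%N)%:P) m) =
  schwarz_poly c m.
Proof.
elim/ltn_ind: m => -[|[|m]] IH; first by rewrite det_mx00.
  by rewrite det_mx11 mxE.
rewrite det_tridiag_mxSS schwarz_polySS -mul_polyC.
have <- := IH m.+1 (ltnSn _); have <- := IH m (ltnW (ltnSn _)).
by rewrite /= subSS subn1.
Qed.

Lemma char_poly_schwarz_mx (R : fieldType) n (b : n.-tuple R) (c : nat -> R) :
  (1 < n)%N -> (forall i, (i < n)%N -> c i = b`_(n - i.+1)) ->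
  char_poly (schwarz_mx b) = schwarz_char c n.
Proof.
case: n b => [|[|n]] // b _ cb.
have -> : char_poly (schwarz_mx b) =
    \det (tridiag_mx (fun i => if i is 0%N then 'X + (b`_0)%:P else 'X)
            (fun i => (c (n.+2 - i.+1)%N)%:P) n.+2).
  congr (\det _); apply/matrixP => i j; rewrite !mxE.
  have [->|nij] := eqVneq i j.
    rewrite eqxx mulr1n; move: (nat_of_ord j) => [|k] /=.
      by rewrite polyCN opprK.
    by rewrite (ltn_eqF (ltnSn _)) subr0.
  rewrite mulr0n sub0r.
  have nij' : (i == j :> nat) = false by apply: contraNF nij => /eqP/val_inj->.
  rewrite nij'; case: ifP => [/andP[/eqP i0 /eqP j0]|_].
    by rewrite i0 j0 in nij'.
  case: ifP => [_|_]; first by rewrite polyC1.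
  case: ifP => [/eqP ij|_]; last by rewrite polyC0 oppr0.
  rewrite polyCN opprK cb; last by have := ltn_ord i; lia.
  by congr (_`_ _)%:P; have := ltn_ord i; lia.
rewrite det_tridiag_mxSS /schwarz_char schwarz_polySS -!mul_polyC.
have <- := det_tridiag_mx_schwarz c n.+1; have <- := det_tridiag_mx_schwarz c n.
by rewrite /= subSS subn1 (cb n.+1) // subnn; ring.
Qed.

(** * The Routh scheme *)

Lemma schwarz_poly_compN (R : fieldType) (c : nat -> R) m :
  schwarz_poly c m \Po (- 'X) = (-1) ^+ m *: schwarz_poly c m.
Proof.
elim/ltn_ind: m => -[|[|m]] IH.
- by rewrite comp_polyC expr0 scale1r.
- by rewrite comp_polyX scaleN1r.
rewrite schwarz_polySS comp_polyD comp_polyM comp_polyZ comp_polyX (IH m.+1) //.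
rewrite (IH m) // scalerDr !exprS !mulN1r opprK !scaleNr mulrNN.
by rewrite !scalerA scalerAr (mulrC (c m)).
Qed.

(** The recursion runs downwards: $s_{n+2}-Xs_{n+1}=c_ns_n$ with $s_n$ monic, so the leading
    coefficient is $c_n$, and dividing by it recovers $s_n$. *)
Lemma eq_schwarz_poly_pair (R : numFieldType) (c d : nat -> R) n :
  (forall i, (i < n)%N -> c i != 0) ->
  schwarz_poly c n.+1 = schwarz_poly d n.+1 ->
  schwarz_poly c n = schwarz_poly d n ->
  forall i, (i < n)%N -> c i = d i.
Proof.
elim: n => // n IH c0 e1 e0.
have ecd : c n *: schwarz_poly c n = d n *: schwarz_poly d n.
  by move: e1; rewrite !schwarz_polySS e0 => /addrI.
have lead a (b : nat -> R) : lead_coef (a *: schwarz_poly b n) = a.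
  by rewrite lead_coefZ (monicP (schwarz_poly_monic b n)) mulr1.
have ecn : c n = d n by rewrite -(lead (c n) c) ecd lead.
have e : schwarz_poly c n = schwarz_poly d n.
  apply: (scalerI (c0 n _)) => //; rewrite ecd ecn //.
by move=> i; rewrite ltnS leq_eqVlt => /predU1P[->//|]; apply: IH => // j jn;
  apply: c0; apply: ltnW.
Qed.

(** The two summands of [schwarz_char] have opposite parities, so equal sums have equal summands,
    and the previous lemma applies to the pair. *)
Lemma schwarz_char_inj (R : numFieldType) (c d : nat -> R) n :
  (forall i, (i < n)%N -> c i != 0) -> (0 < n)%N ->
  schwarz_char c n = schwarz_char d n -> forall i, (i < n)%N -> c i = d i.
Proof.
case: n => // n c0 _; rewrite /schwarz_char -pred_Sn => e.
pose A := schwarz_poly c n.+1 - schwarz_poly d n.+1.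
pose B := c n *: schwarz_poly c n - d n *: schwarz_poly d n.
have AB : A = - B.
  by apply/eqP; rewrite -subr_eq0 opprK /A /B addrACA -opprD e subrr.
have AN : A \Po (- 'X) = (-1) ^+ n.+1 *: A.
  by rewrite /A comp_polyB !schwarz_poly_compN scalerBr.
have BN : B \Po (- 'X) = (-1) ^+ n *: B.
  rewrite /B comp_polyB !comp_polyZ !schwarz_poly_compN scalerBr !scalerA.
  by rewrite ![_ * (-1) ^+ n]mulrC.
have B0 : B = 0.
  move: AN; rewrite AB raddfN /= BN scalerN exprS mulN1r scaleNr opprK => /eqP.
  rewrite -subr_eq0 -opprD oppr_eq0 -scalerDr scaler_eq0 signr_eq0 /=.
  by rewrite -mulr2n -scaler_nat scaler_eq0 pnatr_eq0 => /eqP.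
have {}B0 : c n *: schwarz_poly c n = d n *: schwarz_poly d n.
  by apply/eqP; rewrite -subr_eq0 -/B B0.
have A0 : schwarz_poly c n.+1 = schwarz_poly d n.+1.
  by move: e; rewrite B0 => /addIr.
have lead a (b : nat -> R) : lead_coef (a *: schwarz_poly b n) = a.
  by rewrite lead_coefZ (monicP (schwarz_poly_monic b n)) mulr1.
have ecn : c n = d n by rewrite -(lead (c n) c) B0 lead.
have e0 : schwarz_poly c n = schwarz_poly d n.
  by apply: (scalerI (c0 n _)) => //; rewrite B0 ecn.
move=> i; rewrite ltnS leq_eqVlt => /predU1P[->//|].
by apply: eq_schwarz_poly_pair => // j jn; apply: c0; apply: ltnW.
Qed.

(** The Hurwitz matrix with [u] the odd-indexed and [v] the even-indexed coefficients: rows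
    alternate between [u] and [v], each pair of rows being shifted one place further to the
    right. *)
Definition routh_entry (R : nzRingType) (u v : nat -> R) (r s : nat) : R :=
  if (r./2 <= s)%N then (if odd r then v else u) (s - r./2)%N else 0.

Definition routh_det (R : comNzRingType) (u v : nat -> R) (j : nat) : R :=
  \det (\matrix_(r < j, s < j) routh_entry u v r s).

Lemma sum_delta_nat (R : nzRingType) (F : nat -> R) j r : (r < j)%N ->
  \sum_(k < j) (k == r :> nat)%:R * F k = F r.
Proof.
move=> rj; rewrite (bigD1 (Ordinal rj)) //= eqxx mul1r big1 ?addr0 // => k kr.
rewrite (_ : (k == r :> nat) = false) ?mul0r //.
by apply: contraNF kr => /eqP kr; apply/eqP/val_inj.
Qed.

(* One step of the Routh scheme: a times each row of index 2i is subtracted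
   from the next row, which clears the first column. *)
Lemma routh_detS (R : comNzRingType) (u v : nat -> R) (a : R) j :
  v 0%N = a * u 0%N ->
  routh_det u v j.+1 =
    u 0%N * routh_det (fun i => v i.+1 - a * u i.+1) u j.
Proof.
move=> va.
pose L : 'M[R]_j.+1 := \matrix_(r, k)
  ((k == r :> nat)%:R - (odd r && (k == r.-1 :> nat))%:R * a).
have detL : \det L = 1.
  rewrite det_trig; last first.
    apply/is_trig_mxP => r k rk; rewrite !mxE (gtn_eqF rk).
    rewrite (_ : (k == r.-1 :> nat) = false) ?andbF ?mul0r ?subr0 //.
    by apply/negbTE; lia.
  rewrite big1 // => r _; rewrite mxE eqxx.
  case: (nat_of_ord r) => [|k] /=; first by rewrite mul0r subr0.
  by rewrite (gtn_eqF (ltnSn k)) andbF mul0r subr0.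
rewrite /routh_det; set M := \matrix_(r, s) _.
have LM r s : (L *m M) r s = routh_entry u v r s -
    (if odd r then a * routh_entry u v r.-1 s else 0).
  rewrite mxE; under eq_bigr => k _ do rewrite !mxE mulrBl.
  rewrite sumrB (sum_delta_nat (fun k => routh_entry u v k s)) //; congr (_ - _).
  case: (odd r); last by rewrite big1 // => k _; rewrite !mul0r.
  under eq_bigr => k _ do rewrite -mulrA.
  rewrite (sum_delta_nat (fun k => a * routh_entry u v k s)) //.
  by have := ltn_ord r; lia.
have -> : \det M = \det (L *m M) by rewrite det_mulmx detL mul1r.
(* After the row operations the odd rows carry the new sequence and the even rows still carry [u].
   Without its first row and column the matrix has the same shape, [u] now being in the odd rows. *)
have entryS r s : routh_entry u v r.+1 s -
    (if odd r.+1 then a * routh_entry u v r s else 0) =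
    if s is s'.+1 then routh_entry (fun i => v i.+1 - a * u i.+1) u r s' else 0.
  rewrite /routh_entry -(odd_double_half r); set i := r./2.
  case: (odd r); rewrite /= ?add0n ?add1n /= ?odd_double ?doubleK ?uphalf_double /=.
    by rewrite subr0; case: s => [|s] //; rewrite ltnS subSS.
  case: s => [|s]; first by case: i => [|i]; rewrite /= ?va ?mulr0 subrr.
  have [is_|lt_si] := leqP i s.
    by rewrite leqW // subSn.
  have [is_|_] := leqP i s.+1; last by rewrite mulr0 subr0.
  by rewrite (_ : (s.+1 - i)%N = 0%N) ?va ?subrr //; lia.
rewrite (expand_det_col _ ord0) big_ord_recl big1 ?addr0; last first.
  by move=> r _; rewrite LM lift0 entryS mul0r.
rewrite LM /= subr0 {1}/routh_entry /= /cofactor expr0 mul1r.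
congr (_ * \det _); apply/matrixP => r s.
by rewrite 2!mxE LM mxE !lift0 entryS.
Qed.

Lemma routh_det1 (R : comNzRingType) (u v : nat -> R) : routh_det u v 1 = u 0%N.
Proof. by rewrite /routh_det det_mx11 mxE. Qed.

(** Euclid's algorithm on $V=\sum v_iX^{m+1-2i}$ and $U=\sum u_iX^{m-2i}$: with $a=v_0/u_0$, the
    remainder $W=V-aXU$ has coefficients $w_i=v_{i+1}-au_{i+1}$, and the induction goes on with
    $(W,U)$. The determinants provide $u_0\ne0$ and $w_0\ne0$. Truncated exponents in the sums are
    harmless, since the coefficients there vanish; hence any large [N] will do. *)
Lemma routh_schwarz_poly (R : fieldType) m (u v : nat -> R) :
  (forall i, (m < 2 * i)%N -> u i = 0) ->
  (forall i, (m.+1 < 2 * i)%N -> v i = 0) ->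
  v 0%N != 0 ->
  (forall j, (0 < j <= m.+1)%N -> routh_det u v j != 0) ->
  exists2 c : nat -> R, forall i, (i < m)%N -> c i != 0 &
    (forall N, (m.+1 < 2 * N)%N ->
       \sum_(i < N) v i *: 'X^(m.+1 - 2 * i) = v 0%N *: schwarz_poly c m.+1) /\
    (forall N, (m < 2 * N)%N ->
       \sum_(i < N) u i *: 'X^(m - 2 * i) = u 0%N *: schwarz_poly c m).
Proof.
elim: m u v => [|m IH] u v u0 v0 vn0 H.
  exists (fun=> 1) => //; split=> -[|N] // _; rewrite big_ord_recl big1 ?addr0.
  - by rewrite muln0 subn0 expr1.
  - by move=> i _; rewrite v0 ?scale0r // lift0; lia.
  - by rewrite muln0 subn0.
  - by move=> i _; rewrite u0 ?scale0r // lift0; lia.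
have un0 : u 0%N != 0 by rewrite -(routh_det1 u v) H.
pose a := v 0%N / u 0%N; have va : v 0%N = a * u 0%N by rewrite divfK.
pose w i := v i.+1 - a * u i.+1.
have [||||c c0 [cP1 cP2]] := IH w u.
- by move=> i im; rewrite /w u0 ?v0 ?mulr0 ?subr0 //; lia.
- by move=> i im; rewrite u0.
- by [].
- move=> j jm; have := H j.+1; rewrite (routh_detS _ va) mulf_eq0 negb_or un0 /=.
  by apply; lia.
have wn0 : w 0%N != 0.
  have := H 2%N isT; rewrite (routh_detS _ va) routh_det1 mulf_eq0 negb_or.
  by case/andP.
(* Dividing $V=aXU+W$ by $v_0$ makes all three polynomials monic: $V/v_0=X\,U/u_0+(w_0/v_0)\,W/w_0$,
   which is the recursion with $c_m=w_0/v_0$. *)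
exists (fun i => if i == m then w 0%N / v 0%N else c i) => [i im|].
  have [_|nim] := eqVneq i m; first by rewrite mulf_neq0 ?invr_eq0.
  by apply: c0; lia.
have ec k : (k <= m.+1)%N ->
    schwarz_poly (fun i => if i == m then w 0%N / v 0%N else c i) k =
    schwarz_poly c k.
  by move=> km; apply: eq_schwarz_poly => i ik; rewrite ifN //; apply/eqP; lia.
split=> N Nm; last by rewrite ec // cP1.
rewrite schwarz_polySS eqxx !ec // scalerDr scalerA mulrCA divff // mulr1.
case: N Nm => // N Nm; rewrite -(cP2 N); last by lia.
rewrite {1}va -scalerA scalerAr -(cP1 N.+1); last by lia.
rewrite big_ord_recl [in RHS]big_ord_recl mulrDr scalerDr -addrA; congr (_ + _).
  by rewrite !muln0 !subn0 -scalerAr scalerA -va -exprS.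
rewrite mulr_sumr scaler_sumr -big_split /=; apply: eq_bigr => i _.
rewrite /w scalerBl -scalerAr scalerA /bump /= add1n.
have [im|mi] := leqP (2 * i.+1) m.+1.
  rewrite -exprS (_ : (m.+1 - 2 * i.+1).+1 = (m.+2 - 2 * i.+1)%N); last by lia.
  by rewrite (_ : (m - 2 * i)%N = (m.+2 - 2 * i.+1)%N) 1?addrC ?subrK //; lia.
rewrite u0 // mulr0 !scale0r add0r subr0.
by rewrite (_ : (m - 2 * i)%N = (m.+2 - 2 * i.+1)%N) //; lia.
Qed.

Lemma hurwitz_detE (R : comNzRingType) (p : {poly R}) j :
  hurwitz_det p j =
    routh_det (fun i => hurwitz_coef p (2 * i).+1)
      (fun i => hurwitz_coef p (2 * i)%N) j.
Proof.
congr (\det _); apply/matrixP => r s; rewrite !mxE /routh_entry.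
rewrite -[in LHS](odd_double_half r); set i := r./2.
have neg (k : int) : k < 0 -> hurwitz_coef p k = 0 by case: k.
case: (odd r); have [is_|si] := leqP i s.
- by congr hurwitz_coef; lia.
- by apply: neg; lia.
- by congr hurwitz_coef; lia.
- by apply: neg; lia.
Qed.

Lemma hurwitz_coef_eq0 (R : nzRingType) (p : {poly R}) (k : nat) :
  ((size p).-1 < k)%N -> hurwitz_coef p k = 0.
Proof. by move=> pk; rewrite /hurwitz_coef leqNgt pk. Qed.

Lemma sum_even_odd (V : nmodType) (F : nat -> V) N :
  \sum_(i < 2 * N) F i = \sum_(i < N) F (2 * i)%N + \sum_(i < N) F (2 * i).+1.
Proof.
elim: N => [|N IH]; first by rewrite muln0 !big_ord0 addr0.
rewrite mulnS !big_ord_recr /= IH -!addrA; congr (_ + _).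
by rewrite addrC -!addrA; congr (_ + _); rewrite addrC.
Qed.

Lemma poly_hurwitz_coef (R : nzRingType) (p : {poly R}) N :
  ((size p).-1 < N)%N ->
  p = \sum_(k < N) hurwitz_coef p k *: 'X^((size p).-1 - k).
Proof.
move=> pN; set n := (size p).-1.
have {1}-> : p = \poly_(i < n.+1) p`_i.
  apply/polyP => i; rewrite coef_poly; case: ltnP => // ni.
  by rewrite nth_default // (leq_trans (leqSpred _)).
rewrite poly_def (reindex_inj rev_ord_inj) /=.
rewrite (big_ord_widen N (fun i => p`_(n.+1 - i.+1) *: 'X^(n.+1 - i.+1))) //.
rewrite big_mkcond; apply: eq_bigr => i _; rewrite /hurwitz_coef -/n ltnS subSS.
by case: leqP => // _; rewrite scale0r.
Qed.

Lemma schwarz_char_exists (R : fieldType) (p : {poly R}) n :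
  (0 < n)%N -> p \is monic -> size p = n.+1 ->
  (forall j, (0 < j <= n)%N -> hurwitz_det p j != 0) ->
  exists2 c : nat -> R, forall i, (i < n)%N -> c i != 0 & p = schwarz_char c n.
Proof.
case: n => // n _ mp sp H.
pose u i := hurwitz_coef p (2 * i).+1; pose v i := hurwitz_coef p (2 * i)%N.
have v0 : v 0%N = 1.
  by rewrite /v /hurwitz_coef muln0 leq0n subn0 -lead_coefE (monicP mp).
have u0 : u 0%N != 0.
  have := H 1%N isT; by rewrite hurwitz_detE routh_det1.
have [||||c c0 [cP1 cP2]] := @routh_schwarz_poly _ n u v.
- by move=> i ni; apply: hurwitz_coef_eq0; rewrite sp /=; lia.
- by move=> i ni; apply: hurwitz_coef_eq0; rewrite sp.
- by rewrite v0 oner_neq0.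
- by move=> j jn; have := H j jn; rewrite hurwitz_detE.
(* Here $p=V+U$ with $V=s_{n+1}$, because $v_0=1$, and $U=u_0s_n$; so the last coefficient is
   $u_0=a_1$. *)
exists (fun i => if i == n then u 0%N else c i) => [i im|].
  by have [_ //|nim] := eqVneq i n; apply: c0; lia.
have ec k : (k <= n.+1)%N ->
    schwarz_poly (fun i => if i == n then u 0%N else c i) k =
    schwarz_poly c k.
  by move=> kn; apply: eq_schwarz_poly => i ik; rewrite ifN //; apply/eqP; lia.
rewrite /schwarz_char -pred_Sn eqxx !ec // -(cP2 n.+2); last by lia.
rewrite -[schwarz_poly c n.+1]scale1r -v0 -(cP1 n.+2); last by lia.
rewrite [LHS](@poly_hurwitz_coef _ _ (2 * n.+2)) ?sp /=; last by lia.
rewrite (sum_even_odd (fun k => hurwitz_coef p k *: 'X^(n.+1 - k))).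
congr (_ + _); apply: eq_bigr => i _; rewrite /u.
Qed.

(** * Parity of the number of zeros *)

Section NbZeros.
Variable R : rcfType.
Implicit Types (f g : {poly R}) (I : interval R) (a b x : R).

Lemma mem_rootsR f x : f != 0 -> (x \in rootsR f) = root f x.
Proof. by move=> f0; rewrite -(roots_on_rootsR f0). Qed.

Lemma nb_zeros_uniq f I (s : seq R) :
  f != 0 -> uniq s -> {subset rootsR f <= s} ->
  nb_zeros f I = \sum_(x <- s | x \in I) mup x f.
Proof.
move=> f0 us fs; rewrite /nb_zeros.
rewrite [RHS](bigID (mem (rootsR f))) /= [X in _ + X]big1 ?addr0; last first.
  move=> x /andP[_ nx]; apply: mupNroot; apply: contra nx => rx.
  by rewrite mem_rootsR.
rewrite -[RHS]big_filter -[LHS]big_filter; apply: perm_big.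
apply: uniq_perm; rewrite ?filter_uniq ?(lt_sorted_uniq (sorted_roots _ _ _)) //.
move=> x.
rewrite !mem_filter -andbA; case: (x \in I) => //=.
by apply/idP/andP => [xf|[]] //; rewrite xf fs.
Qed.

Lemma nb_zerosM f g I : f != 0 -> g != 0 ->
  nb_zeros (f * g) I = (nb_zeros f I + nb_zeros g I)%N.
Proof.
move=> f0 g0; set s := undup (rootsR f ++ rootsR g ++ rootsR (f * g)).
have us : uniq s by rewrite undup_uniq.
rewrite !(@nb_zeros_uniq _ _ s) ?mulf_neq0 //; first last.
- by move=> x xf; rewrite mem_undup !mem_cat xf ?orbT.
- by move=> x xf; rewrite mem_undup !mem_cat xf ?orbT.
- by move=> x xf; rewrite mem_undup !mem_cat xf ?orbT.
by rewrite -big_split /=; apply: eq_bigr => x _; rewrite mupM.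
Qed.

Lemma nb_zeros_noroot f I : {in I, forall x, ~~ root f x} -> nb_zeros f I = 0%N.
Proof.
move=> nr; rewrite /nb_zeros big1_seq // => x /andP[/nr fx _].
exact: mupNroot.
Qed.

Lemma nb_zeros_XsubC a I : nb_zeros ('X - a%:P) I = (a \in I).
Proof.
rewrite (@nb_zeros_uniq _ _ [:: a]) ?polyXsubC_eq0 //; last first.
  by move=> x; rewrite mem_rootsR ?polyXsubC_eq0 // root_XsubC inE.
by rewrite big_mkcond big_seq1 (@mup_XsubCX _ 1) eqxx; case: (a \in I).
Qed.

Lemma poly_root_ind (P : {poly R} -> Prop) :
  (forall f, f != 0 -> (forall x, ~~ root f x) -> P f) ->
  (forall a f, f != 0 -> P f -> P (('X - a%:P) * f)) ->
  forall f, f != 0 -> P f.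
Proof.
move=> P0 PX f; have [n] := ubnP (size f); elim: n f => // n IH f fn f0.
have [|nr] := boolP (rootsR f == [::]).
  move=> /eqP rf; apply: P0 => // x; apply/negP => fx.
  by have := mem_rootsR x f0; rewrite rf fx.
have [x /[!mem_rootsR] // /factor_theorem[q fq]] : exists x, x \in rootsR f.
  by case: (rootsR f) nr => // x s _; exists x; rewrite mem_head.
have q0 : q != 0 by apply: contraNneq f0 => q0; rewrite fq q0 mul0r.
rewrite fq mulrC; apply: PX => //; apply: IH => //.
by move: fn; rewrite fq size_Mmonic ?monicXsubC // size_XsubC addn2 /= ltnS.
Qed.

(** Without real zeros this is the intermediate value theorem. A factor $X-c$ changes the sign of
    $f(a)f(b)$ exactly when $a<c<b$. *)
Lemma odd_nb_zeros_oo f a b : a < b -> f.[a] != 0 -> f.[b] != 0 ->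
  odd (nb_zeros f `]a, b[) = (f.[a] * f.[b] < 0).
Proof.
move=> ab; have [->|f0] := eqVneq f 0; first by rewrite horner0 eqxx.
move: f f0.
apply: poly_root_ind => [f f0 nr fa fb|c f f0 IH].
  rewrite nb_zeros_noroot => [|x _]; last exact: nr.
  apply/esym/negbTE/negP => /(poly_ivtoo (ltW ab))[x _ fx].
  by have := nr x; rewrite fx.
rewrite !hornerM !hornerXsubC !mulf_eq0 !negb_or => /andP[ca fa] /andP[cb fb].
rewrite nb_zerosM ?polyXsubC_eq0 // oddD IH // nb_zeros_XsubC.
rewrite mulrACA in_itv /=.
have : f.[a] * f.[b] != 0 by rewrite mulf_neq0.
move: (f.[a] * f.[b]) => y y0.
have [ac|ca'] := ltP a c; have [cb'|bc] := ltP c b => /=.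
- rewrite nmulr_rlt0; last by rewrite nmulr_rlt0 ?subr_lt0 ?subr_gt0.
  by rewrite lt0r y0 ltNge; case: (0 <= y).
- rewrite [RHS]pmulr_rlt0 // nmulr_rgt0 subr_lt0 //.
  by rewrite lt_neqAle -subr_eq0 cb bc.
- rewrite [RHS]pmulr_rlt0 // pmulr_rgt0 subr_gt0 //.
  by rewrite lt_neqAle eq_sym -subr_eq0 ca ca'.
- by have := lt_le_trans ab (le_trans bc ca'); rewrite ltxx.
Qed.

(** Same induction, with $(-1)^{\deg f}$, the sign of a monic $f$ near $-\infty$, in place of the
    value at the left end. *)
Lemma odd_nb_zeros_ninfty f b : f \is monic -> f.[b] != 0 ->
  odd (nb_zeros f `]-oo, b[) = ((-1) ^+ (size f).-1 * f.[b] < 0).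
Proof.
move=> mf; have f0 := monic_neq0 mf; move: mf; move: f f0.
apply: poly_root_ind => [f f0 nr mf fb|c f f0 IH].
  rewrite nb_zeros_noroot => [|x _]; last exact: nr.
  have nr' : {in `]-oo, b], forall x, ~~ root f x} by move=> x _; exact: nr.
  have bb : b \in `]-oo, b] by rewrite in_itv /= lexx.
  have := sgp_minftyP nr' bb; rewrite /sgp_minfty (monicP mf) mulr1 => sb.
  apply/esym/negbTE; rewrite -leNgt; rewrite -sgr_ge0 sgrM sb sgrX sgrN1.
  by rewrite -expr2 sqr_ge0.
rewrite monicMl ?monicXsubC // => mf.
rewrite !hornerM !hornerXsubC !mulf_eq0 !negb_or => /andP[cb fb].
rewrite nb_zerosM ?polyXsubC_eq0 // oddD IH // nb_zeros_XsubC in_itv /=.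
rewrite size_monicM ?monicXsubC // size_XsubC /=.
have e : (-1) ^+ (size f).-1 * f.[b] != 0 by rewrite mulf_neq0 // signr_eq0.
have -> : (-1) ^+ size f * ((b - c) * f.[b]) =
   (c - b) * ((-1) ^+ (size f).-1 * f.[b]).
  by rewrite (polySpred f0) exprS /=; ring.
move: (_ * f.[b]) e => y e.
have [cb'|bc] := ltP c b => /=.
  by rewrite nmulr_rlt0 ?subr_lt0 // lt0r e ltNge; case: (0 <= y).
by rewrite [RHS]pmulr_rlt0 // subr_gt0 lt_neqAle bc -subr_eq0 cb.
Qed.

End NbZeros.

(** * Kernels as sums of signed squares *)

Section KernelSquares.
Variable R : rcfType.
Implicit Types (f g p : {poly R}) (a b x y : R) (z : R[i]).

Definition croot f z := root (map_poly (real_complex R) f) z.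

Lemma crootM f g z : croot (f * g) z = croot f z || croot g z.
Proof. by rewrite /croot rmorphM rootM. Qed.

Lemma croot_real f x : croot f x%:C = root f x.
Proof.
rewrite /croot /root (horner_map (real_complex R)).
by rewrite (fmorph_eq0 (real_complex R)).
Qed.

(** The remainder modulo the quadratic has degree at most one, real coefficients and a nonreal zero,
    hence is zero. *)
Lemma croot_quadratic f a b : b != 0 -> croot f (a +i* b) ->
  ('X - a%:P) ^+ 2 + (b ^+ 2)%:P %| f.
Proof.
move=> b0; set d := _ + _ => fz.
have sd : size d = 3.
  by rewrite size_polyDl size_exp_XsubC // (leq_ltn_trans (size_polyC_leq1 _)).
have d0 : d != 0 by rewrite -size_poly_gt0 sd.
apply/modp_eq0P; set r := f %% d.
have sr : (size r <= 2)%N by have := ltn_modp f d; rewrite sd d0 ltnS.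
have dz : (map_poly (real_complex R) d).[a +i* b] = 0.
  rewrite rmorphD rmorphXn /= map_polyXsubC map_polyC /= !hornerE.
  rewrite -[a +i* b - _]/((a - a) +i* (b - 0)) subrr subr0 /=.
  by apply/eqP; rewrite eq_complex /=; apply/andP; split; apply/eqP; ring.
have rz : (map_poly (real_complex R) r).[a +i* b] = 0.
  move: fz; rewrite /croot {1}(divp_eq f d) rmorphD rmorphM /root !hornerE dz.
  by rewrite mulr0 add0r => /eqP.
move: rz; rewrite (@horner_coef_wide _ 2) ?size_map_poly //.
rewrite !big_ord_recl big_ord0 /= !coef_map /= addr0 expr0 expr1 mulr1 => /eqP.
rewrite eq_complex /= !mul0r subr0 addr0 add0r mulf_eq0 (negbTE b0) orbF.
move=> /andP[/eqP r0 /eqP r1].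
apply/polyP => -[|[|i]]; rewrite coef0.
3: by rewrite nth_default // (leq_trans sr).
  by move: r0; rewrite r1 mul0r addr0.
exact: r1.
Qed.

(** The kernel $(f(x)f(y)-f(-x)f(-y))/(x+y)$ as a sum of weighted squares, at most [k] of them
    negative. The denominator is multiplied out so that $x+y=0$ is covered as well. *)
Definition kernel_squares f (k : nat) :=
  exists2 s : seq (R * {poly R}),
    (count (fun e => (e.1 < 0)%R) s <= k)%N &
    forall x y, f.[x] * f.[y] - f.[- x] * f.[- y] =
      (x + y) * \sum_(e <- s) e.1 * (e.2.[x] * e.2.[y]).

Lemma kernel_squaresC a : kernel_squares a%:P 0.
Proof.
by exists [::] => // x y; rewrite big_nil mulr0 !hornerC subrr.
Qed.

Lemma kernel_squares_XsubC a : kernel_squares ('X - a%:P) (0 < a)%R.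
Proof.
exists [:: (- 2 * a, 1%:P)] => [|x y].
  by rewrite /= addn0 nmulr_rlt0 ?oppr_lt0 //; case: (0 < a).
by rewrite big_seq1 /= !hornerXsubC !hornerC; ring.
Qed.

Lemma kernel_squares_quadratic a b : a <= 0 ->
  kernel_squares (('X - a%:P) ^+ 2 + (b ^+ 2)%:P) 0.
Proof.
(* With $m=a^2+b^2$ the even and odd parts are $x^2+m$ and $-2ax$; their cross terms add up to
   $-4a(x+y)(xy+m)$. *)
move=> a0; exists [:: (- 4 * a, 'X); (- 4 * a * (a ^+ 2 + b ^+ 2), 1%:P)] => [|x y].
  rewrite /= addn0 leqn0 addn_eq0 !eqb0 -!leNgt.
  have h : 0 <= - 4 * a by rewrite mulNr oppr_ge0 pmulr_rle0.
  by rewrite h mulr_ge0 // addr_ge0 ?sqr_ge0.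
rewrite !big_cons big_nil /=.
by rewrite !(hornerX, hornerC, hornerD, horner_exp, hornerN); ring.
Qed.

(** Insert $\pm f(-x)f(-y)g(x)g(y)$: the numerator for $fg$ is $g(x)g(y)$ times that of $f$ plus
    $f(-x)f(-y)$ times that of $g$. *)
Lemma kernel_squaresM f g k l :
  kernel_squares f k -> kernel_squares g l -> kernel_squares (f * g) (k + l).
Proof.
move=> [s sk sf] [t tl tg].
exists ([seq (e.1, g * e.2) | e <- s] ++
        [seq (e.1, (f \Po (- 'X)) * e.2) | e <- t]) => [|x y].
  by rewrite count_cat !count_map; apply: leq_add.
rewrite big_cat !big_map /= mulrDr.
have -> : \sum_(e <- s) e.1 * ((g * e.2).[x] * (g * e.2).[y]) =
    g.[x] * g.[y] * \sum_(e <- s) e.1 * (e.2.[x] * e.2.[y]).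
  by rewrite mulr_sumr; apply: eq_bigr => e _; rewrite !hornerM; ring.
have -> : \sum_(e <- t)
      e.1 * (((f \Po (- 'X)) * e.2).[x] * ((f \Po (- 'X)) * e.2).[y]) =
    f.[- x] * f.[- y] * \sum_(e <- t) e.1 * (e.2.[x] * e.2.[y]).
  rewrite mulr_sumr; apply: eq_bigr => e _.
  by rewrite !hornerM !horner_comp !hornerN !hornerX; ring.
by rewrite !(mulrCA (x + y)) -sf -tg !hornerM; ring.
Qed.

(** Real linear and quadratic factors are split off one at a time; with zeros in the closed left
    half-plane, none contributes a negative weight. *)
Lemma kernel_squares_stable f :
  (forall z, croot f z -> complex.Re z <= 0) -> kernel_squares f 0.
Proof.
have [n] := ubnP (size f); elim: n f => // n IH f fn fz.
have [/size1_polyC->|f1] := leqP (size f) 1; first exact: kernel_squaresC.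
have [z rz] : exists z, croot f z.
  by apply/closed_rootP; rewrite size_map_poly; case: (size f) f1 => [|[]].
case: z rz => a b rz; have a0 : a <= 0 by have := fz _ rz.
have f0 : f != 0 by rewrite -size_poly_gt0 ltnW.
suff [d dP sd] : exists2 d, kernel_squares d 0 /\ d %| f & (1 < size d)%N.
  have [kd /dvdpP[g fE]] := dP.
  have g0 : g != 0 by apply: contraNneq f0 => g0; rewrite fE g0 mul0r.
  rewrite fE mulrC; apply: (kernel_squaresM (k := 0) (l := 0)) => //; apply: IH.
    have d0 : d != 0 by rewrite -size_poly_gt0 ltnW.
    move: fn sd; rewrite fE size_mul //.
    by move: (size g) (size d) => [|u] [|[|v]] //; lia.
  by move=> z zg; apply: fz; rewrite fE crootM zg.
have [b0|b0] := eqVneq b 0.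
  exists ('X - a%:P); last by rewrite size_XsubC.
  split; first by have := kernel_squares_XsubC a; rewrite ltNge a0.
  by rewrite dvdp_XsubCl -croot_real; move: rz; rewrite b0.
exists (('X - a%:P) ^+ 2 + (b ^+ 2)%:P).
  by split; [exact: kernel_squares_quadratic|exact: croot_quadratic].
by rewrite size_polyDl size_exp_XsubC // (leq_ltn_trans (size_polyC_leq1 _)).
Qed.

End KernelSquares.

(** * Inertia: bounding numbers of negative squares *)

Lemma leq_of_kernel (F : fieldType) k t (M : 'M[F]_(k, t)) :
  (forall v : 'rV_k, v *m M = 0 -> v = 0) -> (k <= t)%N.
Proof.
move=> inj; suff /eqP <- : row_free M by exact: rank_leq_col.
rewrite -kermx_eq0; apply/rowV0P => v /sub_kermxP; exact: inj.
Qed.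

Section Inertia.
Variable R : rcfType.
Implicit Types (q : {poly R}) (x y : R).

Lemma sum_kernel_squares n (t v : 'I_n -> R) (I : Type) (r : seq I) (P : pred I)
    (w : I -> R) (q : I -> {poly R}) :
  \sum_a \sum_b v a * v b *
     (\sum_(e <- r | P e) w e * ((q e).[t a] * (q e).[t b])) =
  \sum_(e <- r | P e) w e * (\sum_a v a * (q e).[t a]) ^+ 2.
Proof.
under eq_bigr => a _ do under eq_bigr => b _ do rewrite mulr_sumr.
under eq_bigr => a _ do rewrite exchange_big.
rewrite exchange_big; apply: eq_bigr => e _.
rewrite expr2 mulr_suml mulr_sumr; apply: eq_bigr => a _.
by rewrite !mulr_sumr; apply: eq_bigr => b _; ring.
Qed.

(** Up to transposition, the matrix is a unitriangular coefficient matrix times the Vandermonde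
    matrix of the points $1,\dots,n$. *)
Lemma horner_basis_unitmx n (q : 'I_n -> {poly R}) :
  (forall i, q i \is monic) -> (forall i, size (q i) = i.+1) ->
  \matrix_(a < n, i < n) (q i).[a.+1%:R] \in unitmx.
Proof.
move=> mq sq; set W := \matrix_(a, i) _.
pose t : 'rV[R]_n := \row_a a.+1%:R.
pose C : 'M[R]_n := \matrix_(i, j) (q i)`_j.
have -> : W = (C *m Vandermonde n t)^T.
  apply/matrixP => a i; rewrite !mxE (@horner_coef_wide _ n) ?sq ?ltn_ord //.
  by apply: eq_bigr => j _; rewrite !mxE.
rewrite unitmxE det_tr det_mulmx det_Vandermonde det_trig; last first.
  by apply/is_trig_mxP => i j ij; rewrite mxE nth_default // sq.
rewrite big1 ?mul1r => [|i _]; last first.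
  by rewrite mxE -(monicP (mq i)) lead_coefE sq.
rewrite unitfE; apply/prodf_neq0 => i _; apply/prodf_neq0 => j ij.
by rewrite !mxE subr_eq0 eqr_nat eqSS gtn_eqF.
Qed.

(** Sylvester's law of inertia. On vectors supported where $d_i<0$ the form is nonpositive; where
    all negative squares of [s] vanish it is nonnegative. A vector of both kinds is zero, so there
    are at least as many vanishing conditions as negative $d_i$. *)
Lemma negative_squares_leq n (q : 'I_n -> {poly R}) (d : 'I_n -> R)
    (s : seq (R * {poly R})) :
  (forall i, q i \is monic) -> (forall i, size (q i) = i.+1) ->
  (forall x y, 0 < x -> 0 < y ->
     \sum_i d i * ((q i).[x] * (q i).[y]) =
     \sum_(e <- s) e.1 * (e.2.[x] * e.2.[y])) ->
  (#|[set i | (d i < 0)%R]| <= count (fun e => (e.1 < 0)%R) s)%N.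
Proof.
move=> mq sq dqs; set S := [set i | _]; set neg := fun e => _.
pose t (a : 'I_n) : R := a.+1%:R.
set W : 'M_n := \matrix_(a < n, i < n) (q i).[t a].
have uW : W \in unitmx by exact: horner_basis_unitmx.
pose E : 'M[R]_(#|S|, n) := \matrix_(j, i) (enum_val j == i)%:R.
pose s' := [seq e <- s | neg e].
pose N : 'M[R]_(n, size s') := \matrix_(a, j) (nth (0, 0) s' j).2.[t a].
rewrite -size_filter -/s'; apply: (@leq_of_kernel _ _ _ (E *m invmx W *m N)).
(* [v] weights the sample points so that $\sum_a v_aq_i(t_a)$ is the coordinate of [x] at $i$ if
   $i\in S$, and zero otherwise. The points $1,\dots,n$ are positive, as [dqs] requires. *)
move=> x xN; set v := x *m (E *m invmx W).
have vW : v *m W = x *m E by rewrite /v -!mulmxA mulVmx // mulmx1.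
have key : \sum_i d i * ((x *m E) 0 i) ^+ 2 =
    \sum_(e <- s) e.1 * (\sum_a v 0 a * e.2.[t a]) ^+ 2.
  transitivity (\sum_i d i * (\sum_a v 0 a * (q i).[t a]) ^+ 2).
    apply: eq_bigr => i _; rewrite -vW mxE; congr (_ * _ ^+ 2).
    by apply: eq_bigr => a _; rewrite !mxE.
  rewrite -(sum_kernel_squares t (v 0) _ xpredT d q).
  rewrite -(sum_kernel_squares t (v 0) s xpredT (fun e => e.1) (fun e => e.2)).
  apply: eq_bigr => a _; apply: eq_bigr => b _; congr (_ * _).
  by apply: dqs; rewrite ltr0Sn.
have xE0 i : i \notin S -> (x *m E) 0 i = 0.
  move=> iS; rewrite mxE big1 // => j _; rewrite mxE.
  by case: eqP iS => [<-|]; rewrite ?enum_valP ?mulr0.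
have xE j : (x *m E) 0 (enum_val j) = x 0 j.
  rewrite mxE (bigD1 j) //= mxE eqxx mulr1 big1 ?addr0 // => k kj.
  by rewrite mxE (inj_eq enum_val_inj) (negbTE kj) mulr0.
have term_le0 i : d i * (x *m E) 0 i ^+ 2 <= 0.
  have [|iS] := boolP (i \in S); last by rewrite xE0 // expr0n mulr0.
  by rewrite inE => di; rewrite nmulr_rle0 // sqr_ge0.
have rhs0 : 0 <= \sum_(e <- s) e.1 * (\sum_a v 0 a * e.2.[t a]) ^+ 2.
  rewrite big_seq; apply: sumr_ge0 => e es.
  have [ne|] := boolP (neg e); last first.
    by rewrite -leNgt => e0; rewrite mulr_ge0 ?sqr_ge0.
  have es' : e \in s' by rewrite mem_filter ne.
  have lt_e : (index e s' < size s')%N by rewrite index_mem.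
  have e0 : (v *m N) 0 (Ordinal lt_e) = 0 by rewrite /v -mulmxA xN mxE.
  rewrite mxE in e0; rewrite [X in X ^+ 2](_ : _ = 0) ?expr0n ?mulr0 //.
  by rewrite -[RHS]e0; apply: eq_bigr => a _; rewrite [N _ _]mxE nth_index.
have : \sum_i - (d i * ((x *m E) 0 i) ^+ 2) == 0.
  rewrite sumrN oppr_eq0 eq_le key rhs0 andbT -key -oppr_ge0 -sumrN.
  by apply: sumr_ge0 => i _; rewrite oppr_ge0.
rewrite psumr_eq0 => [/allP h|i _]; last by rewrite oppr_ge0.
apply/rowP => j; have := h (enum_val j) (mem_index_enum _).
rewrite xE oppr_eq0 mulf_eq0 sqrf_eq0 mxE => /orP[/eqP d0|/eqP //].
by have := enum_valP j; rewrite inE d0 ltxx.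
Qed.

(* The weights are the values at the mu_a of the kernel of the stable
   polynomial prod (X + mu_a), up to a diagonal scaling. *)
Lemma cauchy_form_ge0 k (m w : 'I_k -> R) : (forall a, 0 < m a) ->
  0 <= \sum_a \sum_b w a * w b * (m a + m b)^-1.
Proof.
move=> m0; pose g := \prod_a ('X - (- m a)%:P).
have gN a : g.[- m a] = 0.
  apply/rootP; rewrite /g (bigD1 a) //= rootM root_XsubC eqxx //.
have g0 a : 0 < g.[m a].
  rewrite horner_prod; apply: prodr_gt0 => b _.
  by rewrite hornerXsubC opprK addr_gt0.
have [s sneg sg] : kernel_squares g 0.
  apply: kernel_squares_stable => z; rewrite /croot rmorph_prod /=.
  under eq_bigr => a _ do rewrite map_polyXsubC.
  rewrite -(big_map (fun a => real_complex R (- m a)) xpredT (fun u => 'X - u%:P)).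
  rewrite root_prod_XsubC => /mapP[a _ ->] /=.
  by rewrite oppr_le0 ltW.
rewrite (eq_bigr (fun a => \sum_b (w a / g.[m a]) * (w b / g.[m b]) *
    (\sum_(e <- s) e.1 * (e.2.[m a] * e.2.[m b])))) => [|a _].
  rewrite sum_kernel_squares big_seq; apply: sumr_ge0 => e es.
  rewrite mulr_ge0 ?sqr_ge0 // leNgt; apply/negP => en.
  by move: sneg; rewrite leqNgt -has_count => /hasP; apply; exists e.
apply: eq_bigr => b _; have := sg (m a) (m b); rewrite !gN mulr0 subr0.
move: (\sum_(e <- s) _) => S gS.
have mab : m a + m b != 0 by rewrite gt_eqF // addr_gt0.
have -> : S = g.[m a] * g.[m b] / (m a + m b) by rewrite gS mulrC mulKf.
by field; rewrite mab !gt_eqF.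
Qed.

Lemma eq_poly_infinite (p q : {poly R}) :
  (forall x, p.[x] = q.[x]) -> p = q.
Proof.
move=> pq; apply/eqP; rewrite -subr_eq0; apply/eqP.
apply: (@roots_geq_poly_eq0 _ _ [seq i%:R | i <- iota 0 (size (p - q))]).
- by apply/allP => x _; rewrite /root hornerD hornerN pq subrr.
- by rewrite map_inj_uniq ?iota_uniq //; apply: (mulrIn (oner_neq0 _)).
- by rewrite size_map size_iota.
Qed.

End Inertia.

(** * Zeros in the closed right half-plane *)

Section Pattern.
Variable R : rcfType.
Implicit Types (f g p : {poly R}) (mu : seq R) (x y : R) (z : R[i]).

(* For p of even degree, this is what being almost generalized Hurwitz amounts
   to, up to a bound on the order: the real zeros of the odd polynomial X p(X)
   in the definition are counted through the signs of p(- x) for x in mu. *)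
Record rhp_pattern p mu : Prop := RhpPattern {
  rhp_sorted : sorted <%R mu;
  rhp_gt0 : forall x, x \in mu -> 0 < x;
  rhp_roots : forall z,
    croot p z /\ 0 <= complex.Re z <-> (exists2 x, x \in mu & z = x%:C);
  rhp_sign : forall x, x \in mu -> 0 < p^`().[x] * p.[- x]
}.

(** A zero of the cofactor in the closed right half-plane would be some [x] in [mu], hence a double
    zero of $p$, against $p'(x)\ne0$. *)
Lemma simple_rhp_factor p mu :
  uniq mu ->
  (forall z, croot p z /\ 0 <= complex.Re z <->
     (exists2 x, x \in mu & z = x%:C)) ->
  (forall x, x \in mu -> p^`().[x] != 0) ->
  exists2 g, p = g * \prod_(m <- mu) ('X - m%:P) &
    forall z, croot g z -> complex.Re z < 0.
Proof.
move=> umu muP dmu; have [||g pg] := @uniq_roots_prod_XsubC _ p mu.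
- apply/allP => x xmu; rewrite -croot_real.
  by have [] := (muP x%:C).2 (ex_intro2 _ _ x xmu erefl).
- by rewrite uniq_rootsE.
exists g => // z gz; rewrite ltNge; apply/negP => z0.
have [|x xmu zx] := (muP z).1; first by rewrite pg crootM gz.
have := dmu _ xmu; rewrite pg derivM hornerD !hornerM.
have /rootP-> : root g x by rewrite -croot_real -zx.
have /rootP-> : root (\prod_(m <- mu) ('X - m%:P)) x by rewrite root_prod_XsubC.
by rewrite mulr0 mul0r addr0 eqxx.
Qed.

Lemma rhp_root p mu x : rhp_pattern p mu -> x \in mu -> p.[x] = 0.
Proof.
move=> H xmu; have [pz _] := (rhp_roots H x%:C).2 (ex_intro2 _ _ x xmu erefl).
by apply/rootP; rewrite -croot_real.
Qed.

Lemma rhp_deriv_neq0 p mu x : rhp_pattern p mu -> x \in mu -> p^`().[x] != 0.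
Proof.
move=> H xmu; apply: contraTneq (rhp_sign H xmu) => ->.
by rewrite mul0r ltxx.
Qed.

Lemma rhp_pattern_factor p mu : rhp_pattern p mu ->
  exists2 g, p = g * \prod_(m <- mu) ('X - m%:P) &
    forall z, croot g z -> complex.Re z < 0.
Proof.
move=> H; apply: simple_rhp_factor (rhp_roots H) _ => [|x xmu].
  exact: lt_sorted_uniq (rhp_sorted H).
exact: rhp_deriv_neq0 H xmu.
Qed.

(** Each factor $X-m$ costs at most one negative square and the stable cofactor costs none. *)
Lemma kernel_squares_pattern p mu : rhp_pattern p mu -> kernel_squares p (size mu).
Proof.
move=> /rhp_pattern_factor[g -> gz]; rewrite mulrC -(addn0 (size mu)).
apply: kernel_squaresM; last by apply: kernel_squares_stable => z /gz/ltW.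
elim: mu {gz} => [|m mu IH]; first by rewrite big_nil; apply: kernel_squaresC.
rewrite big_cons /= -add1n; apply: kernel_squaresM => //.
have [s sk sE] := kernel_squares_XsubC m; exists s => //.
exact: leq_trans sk (leq_b1 _).
Qed.

(** The coefficient $d_i$ of $s_i(x)s_i(y)$ in the kernel; in terms of the matrix it is $2b_0\cdots
    b_{n-1-i}$. *)
Definition schwarz_weight (c : nat -> R) (n i : nat) : R :=
  2 * \prod_(i <= j < n) c j.

Section Weights.
Variables (c : nat -> R) (n : nat) (mu : seq R).
Hypotheses (n0 : (0 < n)%N) (en : ~~ odd n).
Let p := schwarz_char c n.
Hypothesis H : rhp_pattern p mu.
Let s i := schwarz_poly c i.
Let d i := schwarz_weight c n i.
Let K x y := \sum_(i < n) d i * ((s i).[x] * (s i).[y]).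

Let KE x y : p.[x] * p.[y] - p.[- x] * p.[- y] = (x + y) * K x y.
Proof. exact: schwarz_char_kernel. Qed.

Lemma negative_weights_leq :
  (#|[set i : 'I_n | (schwarz_weight c n i < 0)%R]| <= size mu)%N.
Proof.
have [t tmu tE] := kernel_squares_pattern H; apply: leq_trans tmu.
apply: (@negative_squares_leq _ _ (fun i => s i)) => [i|i|x y x0 y0].
- exact: schwarz_poly_monic.
- exact: size_schwarz_poly.
have xy : x + y != 0 by rewrite gt_eqF // addr_gt0.
by apply: (mulfI xy); rewrite -tE -KE.
Qed.

Let odd_part x y :
  \sum_(i < n | odd i) d i * ((s i).[x] * (s i).[y]) = (K x y - K (- x) y) / 2.
Proof.
rewrite /K -sumrB mulr_suml [RHS](bigID (fun i : 'I_n => odd i)) /=.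
rewrite [X in _ + X]big1 ?addr0 => [|i /negbTE oi]; last first.
  by rewrite horner_schwarz_polyN -signr_odd oi; field.
by apply: eq_bigr => i oi; rewrite horner_schwarz_polyN -signr_odd oi; field.
Qed.

(** At a zero $x$ of $p$ the kernel is $K(-x,y)=p(-x)p(y)/(y-x)$. Its value at $y=x$ comes from
    differentiating the polynomial identity $(y-x)K(-x,y)=p(-x)p(y)$. *)
Let K_diag x : p.[x] = 0 -> K (- x) x = p.[- x] * p^`().[x].
Proof.
move=> px; pose T := \sum_(i < n) (d i * (s i).[- x]) *: s i.
have TE y : T.[y] = K (- x) y.
  by rewrite horner_sum; apply: eq_bigr => i _; rewrite hornerZ mulrA.
have e : ('X - x%:P) * T = p.[- x] *: p.
  apply: eq_poly_infinite => y; rewrite hornerM hornerXsubC hornerZ TE.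
  by rewrite addrC -KE opprK px mul0r subr0.
have := congr1 (fun q => q^`().[x]) e.
rewrite derivM derivXsubC mul1r hornerD hornerM hornerXsubC subrr mul0r addr0.
by rewrite TE derivZ hornerZ.
Qed.

(** If [v] kills all odd squares of negative weight, the odd form $Q$ is nonnegative at [v]. But
    $Q=-(A+B)/2$ with $A\ge0$ a Cauchy form and $B$ a diagonal form, positive definite by
    [rhp_sign]; so $v=0$. *)
Lemma odd_negative_weights_geq :
  (size mu <= #|[set i : 'I_n | odd i & (schwarz_weight c n i < 0)%R]|)%N.
Proof.
set S := [set i | _]; pose m (a : 'I_(size mu)) := mu`_a.
have mmu a : m a \in mu by rewrite mem_nth.
have m0 a : 0 < m a := rhp_gt0 H (mmu a).
have pm a : p.[m a] = 0 := rhp_root H (mmu a).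
have m_inj : injective m.
  move=> a b /eqP; rewrite nth_uniq ?lt_sorted_uniq ?(rhp_sorted H) //.
  by move=> /eqP/val_inj.
apply: (@leq_of_kernel _ _ _
  (\matrix_(a < size mu, j < #|S|) (s (enum_val j)).[m a])) => v vM.
pose Q := \sum_(i < n | odd i) d i * (\sum_a v 0 a * (s i).[m a]) ^+ 2.
have Q0 : 0 <= Q.
  apply: sumr_ge0 => i oi; have [di|] := ltP (d i) 0; last first.
    by move=> di; rewrite mulr_ge0 ?sqr_ge0.
  have iS : i \in S by rewrite inE oi.
  have := congr1 (fun A : 'rV_ _ => A 0 (enum_rank_in iS i)) vM.
  rewrite !mxE => e0; rewrite [X in X ^+ 2](_ : _ = 0) ?expr0n ?mulr0 //.
  by rewrite -[RHS]e0; apply: eq_bigr => a _; rewrite mxE enum_rankK_in.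
pose A := \sum_a \sum_b (v 0 a * p.[- m a]) * (v 0 b * p.[- m b]) * (m a + m b)^-1.
pose B := \sum_a v 0 a ^+ 2 * (p^`().[m a] * p.[- m a]).
have A0 : 0 <= A by apply: cauchy_form_ge0.
(* $K(m_a,m_b)$ gives the Cauchy term. $K(-m_a,m_b)$ vanishes for $a\ne b$, both points being zeros
   of $p$, and is given by [K_diag] for $a=b$. *)
have oddK a b : \sum_(i < n | odd i) d i * ((s i).[m a] * (s i).[m b]) =
    - (p.[- m a] * p.[- m b] / (m a + m b) +
       (b == a)%:R * (p^`().[m a] * p.[- m a])) / 2.
  rewrite odd_part; have mab : m a + m b != 0 by rewrite gt_eqF // addr_gt0.
  have -> : K (m a) (m b) = - (p.[- m a] * p.[- m b]) / (m a + m b).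
    by apply: (mulfI mab); rewrite -KE !pm mul0r sub0r [RHS]mulrC divfK.
  have [->|ba] := eqVneq b a; first rewrite (K_diag (pm a)) /= mulr1n.
    by field; rewrite gt_eqF // addr_gt0.
  have -> : K (- m a) (m b) = 0.
    have mab' : - m a + m b != 0 by rewrite addrC subr_eq0 (inj_eq m_inj).
    by apply: (mulfI mab'); rewrite -KE opprK !pm mulr0 mul0r subrr mulr0.
  by rewrite /= mulr0n; field; rewrite gt_eqF // addr_gt0.
have QE : Q = - (A + B) / 2.
  rewrite /Q.
  rewrite -(sum_kernel_squares m (v 0) _ _ (fun i : 'I_n => d i) (fun i => s i)).
  rewrite /A /B -big_split /= -sumrN mulr_suml.
  apply: eq_bigr => a _.
  transitivity (\sum_b
      - (v 0 a * p.[- m a] * (v 0 b * p.[- m b]) / (m a + m b) +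
      (b == a)%:R * (v 0 a * v 0 b * (p^`().[m a] * p.[- m a]))) / 2).
    by apply: eq_bigr => b _; rewrite oddK; field; rewrite gt_eqF // addr_gt0.
  rewrite -mulr_suml sumrN big_split /=; congr (- (_ + _) / _).
  rewrite (bigD1 a) //= eqxx mul1r expr2 big1 ?addr0 // => b /negbTE->.
  by rewrite mul0r.
have B0 : B = 0.
  apply/eqP; rewrite eq_le; apply/andP; split.
    by move: Q0; rewrite QE pmulr_lge0 ?invr_gt0 // oppr_ge0; lra.
  by apply: sumr_ge0 => a _; rewrite mulr_ge0 ?sqr_ge0 // ltW // (rhp_sign H).
apply/rowP => a; rewrite mxE; move/eqP: B0.
rewrite psumr_eq0 => [/allP/(_ a (mem_index_enum _)) /=|b _]; last first.
  by rewrite mulr_ge0 ?sqr_ge0 // ltW // (rhp_sign H).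
by rewrite mulf_eq0 sqrf_eq0 (gt_eqF (rhp_sign H (mmu a))) orbF => /eqP.
Qed.

(** The two bounds squeeze: the negative weights of odd index are already [size mu] in number, so no
    negative weight has even index. *)
Lemma rhp_pattern_weights :
  (forall i, (i < n)%N -> c i != 0) ->
  (forall i, (i < n)%N -> ~~ odd i -> 0 < schwarz_weight c n i) /\
  #|[set i : 'I_n | odd i & (schwarz_weight c n i < 0)%R]| = size mu.
Proof.
move=> c0; set S := [set i : 'I_n | _ & _].
pose T := [set i : 'I_n | (schwarz_weight c n i < 0)%R].
have ST : S \subset T by apply/subsetP => i /[!inE] /andP[].
have cardST : #|S| = #|T|.
  apply/eqP; rewrite eqn_leq subset_leq_card //.
  exact: leq_trans negative_weights_leq odd_negative_weights_geq.
split; last first.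
  apply/eqP; rewrite eqn_leq odd_negative_weights_geq andbT cardST.
  exact: negative_weights_leq.
move=> i i_n oi; rewrite lt0r; apply/andP; split.
  rewrite mulf_neq0 ?pnatr_eq0 // prodf_seq_neq0; apply/allP => j.
  by rewrite mem_index_iota => /andP[_ jn]; rewrite c0.
rewrite leNgt; apply: contra oi => di.
have := subset_cardP cardST ST (Ordinal i_n).
by rewrite !inE di andbT.
Qed.

Let even_part x y :
  \sum_(i < n | ~~ odd i) d i * ((s i).[x] * (s i).[y]) = (K x y + K (- x) y) / 2.
Proof.
rewrite /K -big_split mulr_suml [RHS](bigID (fun i : 'I_n => ~~ odd i)) /=.
rewrite [X in _ + X]big1 ?addr0 => [|i /negbNE oi]; last first.
  by rewrite horner_schwarz_polyN -signr_odd oi; field.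
by apply: eq_bigr => i /negbTE oi; rewrite horner_schwarz_polyN -signr_odd oi; field.
Qed.

(** The even form at $(x,x)$ is positive because of the term $s_0=1$, and twice it is
    $K(x,x)+K(-x,x)=-p(-x)^2/(2x)+p(-x)p'(x)$. *)
Lemma schwarz_char_root_sign x :
  (forall i, (i < n)%N -> ~~ odd i -> 0 < schwarz_weight c n i) ->
  0 < x -> p.[x] = 0 -> 0 < p^`().[x] * p.[- x].
Proof.
move=> dpos x0 px.
have : 0 < \sum_(i < n | ~~ odd i) d i * ((s i).[x] * (s i).[x]).
  rewrite (bigD1 (Ordinal n0)) //=; apply: ltr_wpDr.
    apply: sumr_ge0 => i /andP[oi _].
    by rewrite -expr2 mulr_ge0 ?sqr_ge0 // ltW // dpos.
  by rewrite hornerC !mulr1; apply: dpos.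
rewrite even_part K_diag // pmulr_lgt0 ?invr_gt0 // => h.
have Kle0 : K x x <= 0.
  have xx : 0 < x + x by rewrite addr_gt0.
  by rewrite -(pmulr_rle0 _ xx) -KE px mul0r sub0r oppr_le0 -expr2 sqr_ge0.
by rewrite mulrC; apply: lt_le_trans h _; rewrite gerDr.
Qed.

End Weights.
End Pattern.

(** * Complex zeros when the even weights are positive *)

Lemma map_schwarz_poly (F K : fieldType) (h : {rmorphism F -> K})
    (c : nat -> F) m :
  map_poly h (schwarz_poly c m) = schwarz_poly (h \o c) m.
Proof.
elim/ltn_ind: m => -[|[|m]] IH; first by rewrite rmorph1.
  by rewrite map_polyX.
by rewrite !schwarz_polySS rmorphD rmorphM /= map_polyX map_polyZ !IH.
Qed.

Lemma map_schwarz_char (F K : fieldType) (h : {rmorphism F -> K})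
    (c : nat -> F) n :
  map_poly h (schwarz_char c n) = schwarz_char (h \o c) n.
Proof. by rewrite rmorphD /= map_polyZ !map_schwarz_poly. Qed.

(** A common zero of two consecutive polynomials would propagate down the recursion to $s_0=1$. *)
Lemma schwarz_poly_no_common_root (F : fieldType) (c : nat -> F) n (x : F) :
  (forall i, (i < n)%N -> c i != 0) ->
  (schwarz_poly c n.+1).[x] = 0 -> (schwarz_poly c n).[x] != 0.
Proof.
elim: n => [|n IH] c0 => [_|]; first by rewrite hornerC oner_neq0.
rewrite horner_schwarz_polySS => /eqP; apply: contraTneq => s0.
rewrite s0 mulr0 add0r mulf_neq0 ?c0 // IH // => i ni; apply: c0; exact: ltnW.
Qed.

Lemma horner_map_conj (R : rcfType) (q : {poly R}) (z : R[i]) :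
  (map_poly (real_complex R) q).[z^*] = ((map_poly (real_complex R) q).[z])^*.
Proof.
have E : map_poly Num.conj (map_poly (real_complex R) q) =
         map_poly (real_complex R) q.
  rewrite -map_poly_comp; apply: eq_map_poly => x /=.
  by rewrite conj_Creal // complex_real.
by rewrite -{1}E horner_map.
Qed.

Section ComplexRoots.
Variable R : rcfType.
Implicit Types (z : R[i]).
Variables (c : nat -> R) (n : nat).
Hypotheses (n0 : (0 < n)%N) (en : ~~ odd n).
Hypothesis c0 : forall i, (i < n)%N -> c i != 0.
Hypothesis wpos : forall i, (i < n)%N -> ~~ odd i -> 0 < schwarz_weight c n i.
Let cc := real_complex R \o c.
Let p := schwarz_char c n.
Let P := schwarz_char cc n.

Let P_conj z : P.[z^*] = (P.[z])^*.
Proof. by rewrite /P -(map_schwarz_char (real_complex R)) horner_map_conj. Qed.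

Let S_conj i z : (schwarz_poly cc i).[z^*] = ((schwarz_poly cc i).[z])^*.
Proof. by rewrite -(map_schwarz_poly (real_complex R)) horner_map_conj. Qed.

Lemma schwarz_char_rhp_root z :
  croot p z -> 0 <= complex.Re z -> complex.Im z = 0 /\ 0 < complex.Re z.
Proof.
rewrite /croot map_schwarz_char -/P => /rootP Pz Rz.
(* On the imaginary axis $\bar z=-z$, so $p(z)=p(-z)=0$; then the even and odd parts of $p$ vanish
   separately, giving a common zero of $s_n$ and $s_{n-1}$. *)
have Rz0 : complex.Re z != 0.
  apply/eqP => rz0.
  have zN : z^* = - z.
    case: z rz0 {Pz Rz} => a b /= ->.
    by apply/eqP; rewrite eq_complex /= oppr0 !eqxx.
  have PNz : P.[- z] = 0 by rewrite -zN P_conj Pz rmorph0.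
  move: Pz PNz; rewrite /P /schwarz_char !hornerD !hornerZ !horner_schwarz_polyN.
  case: (n) n0 en c0 => // m _ em cm; have om : odd m by move: em => /= /negbNE.
  rewrite -pred_Sn exprS -(signr_odd _ m) om expr1 => e1 e2.
  have s1 : (schwarz_poly cc m.+1).[z] = 0.
    apply: (mulfI (_ : 2 != 0)); first by rewrite pnatr_eq0.
    by rewrite mulr0; have := congr2 +%R e1 e2; rewrite addr0 => <-; ring.
  have /eqP : (schwarz_poly cc m).[z] != 0.
    apply: schwarz_poly_no_common_root s1 => i im.
    by rewrite fmorph_eq0 cm // ltnW.
  apply; move: e1; rewrite s1 add0r => /eqP.
  by rewrite mulf_eq0 fmorph_eq0 (negbTE (cm _ _)) // => /eqP.
have {}Rz : 0 < complex.Re z by rewrite lt0r Rz0.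
split=> //; apply/eqP/negPn/negP => Iz.
pose S i := schwarz_poly cc i; pose W i : R[i] := 2 * \prod_(i <= j < n) cc j.
have WE i : W i = (schwarz_weight c n i)%:C.
  by rewrite /W /schwarz_weight !rmorphM rmorph_prod /= rmorph_nat.
have P_conj0 : P.[z^*] = 0 by rewrite P_conj Pz rmorph0.
pose T := \sum_(i < n) W i * ((S i).[z] * (S i).[z^*]).
(* The kernel vanishes at $(-z,\bar z)$ because $z$ is nonreal. Adding it to the kernel [T] at
   $(z,\bar z)$ cancels the odd terms and doubles the even ones, so $T>0$; yet $(z+\bar
   z)T=-|p(-z)|^2\le0$. *)
have T2 : \sum_(i < n) W i * ((S i).[- z] * (S i).[z^*]) = 0.
  have zz : - z + z^* != 0.
    rewrite addrC subr_eq0; apply: contra Iz => /eqP/(congr1 (@complex.Im _)).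
    case: (z) => a b /= /eqP.
    by rewrite -subr_eq0 -opprD oppr_eq0 -mulr2n mulrn_eq0.
  apply: (mulfI zz); rewrite -(schwarz_char_kernel cc _ _ n0 en) -/P opprK Pz P_conj0.
  by rewrite mulr0 mul0r subrr mulr0.
have T1 : (z + z^*) * T = - (P.[- z] * (P.[- z])^*).
  rewrite -(schwarz_char_kernel cc _ _ n0 en) -/P Pz mul0r sub0r.
  by congr (- (_ * _)); have := P_conj (- z); rewrite rmorphN.
have Tpos : 0 < T.
  have -> : T = \sum_(i < n) (1 + (-1) ^+ i) * (W i * ((S i).[z] * (S i).[z^*])).
    rewrite -[LHS]addr0 -[X in _ + X = _]T2 -big_split; apply: eq_bigr => i _.
    by rewrite /= horner_schwarz_polyN; ring.
  have nonneg i : 0 <= (S i).[z] * (S i).[z^*].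
    by rewrite S_conj; exact: mul_conjC_ge0.
  rewrite (bigD1 (Ordinal n0)) //=; apply: ltr_wpDr.
    apply: sumr_ge0 => i _; have [oi|oi] := boolP (odd i).
      by rewrite -signr_odd oi expr1 subrr mul0r.
    rewrite -signr_odd (negbTE oi) expr0 mulr_ge0 ?addr_ge0 ?ler01 // mulr_ge0 //.
    by rewrite WE ler0c ltW // wpos.
  rewrite expr0 !hornerC !mulr1 mulr_gt0 ?addr_gt0 ?ltr01 // WE ltcR.
  exact: wpos.
have zz : 0 < z + z^*.
  case: (z) Rz => a b /= a0.
  by rewrite ltcE /= addrN eqxx /= addr_gt0.
have : 0 < (z + z^*) * T by rewrite mulr_gt0.
rewrite T1 oppr_gt0 => /lt_geF; rewrite (_ : 0 <= _ = true) //.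
exact: mul_conjC_ge0.
Qed.

Lemma schwarz_char_rhp_pattern : exists mu, rhp_pattern p mu.
Proof.
have p0 : p != 0 by rewrite monic_neq0 // schwarz_char_monic.
have mem x : x \in [seq x <- rootsR p | 0 < x] = (0 < x) && root p x.
  by rewrite mem_filter mem_rootsR.
exists [seq x <- rootsR p | 0 < x]; split=> [|x|z|x].
- by rewrite (sorted_filter lt_trans) // sorted_roots.
- by rewrite mem => /andP[].
- split=> [[pz Rz]|[x /[!mem] /andP[x0 px] ->]]; last first.
    by split; [rewrite croot_real|exact: ltW].
  have [Iz Rz'] := schwarz_char_rhp_root pz Rz.
  have zE : z = (complex.Re z)%:C by apply/eqP; rewrite eq_complex Iz /= !eqxx.
  by exists (complex.Re z) => //; rewrite mem Rz' -croot_real -zE.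
- by rewrite mem => /andP[x0 /rootP px]; exact: schwarz_char_root_sign.
Qed.

End ComplexRoots.

(** * Almost generalized Hurwitz polynomials *)

Section GenHurwitz.
Variable R : rcfType.
Implicit Types (f g p : {poly R}) (mu : seq R) (x y : R) (z : R[i]).

Lemma prod_sub_sign x mu : (forall m, m \in mu -> x < m) ->
  0 < (-1) ^+ size mu * \prod_(m <- mu) (x - m).
Proof.
elim: mu => [|m mu IH] xm; first by rewrite big_nil mulr1 ltr01.
rewrite big_cons /= exprS mulrACA mulN1r opprB mulr_gt0 //.
  by rewrite subr_gt0 xm ?mem_head.
by apply: IH => y ymu; apply: xm; rewrite inE ymu orbT.
Qed.

Lemma horner_deriv_XsubCM p x y :
  (('X - y%:P) * p)^`().[x] = p.[x] + (x - y) * p^`().[x].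
Proof. by rewrite derivM derivXsubC mul1r hornerD hornerM hornerXsubC. Qed.

(** At a simple zero $\mu$ the derivative is the product of the other factors there; the negative
    ones come from the zeros to the right of $\mu$. *)
Lemma sorted_deriv_sign g mu : sorted <%R mu ->
  (forall x, x \in mu -> 0 < g.[x]) ->
  forall i, (i < size mu)%N ->
    0 < (-1) ^+ (size mu - i.+1) *
        (g * \prod_(m <- mu) ('X - m%:P))^`().[mu`_i].
Proof.
elim: mu => // a mu IH sa g0; have smu := path_sorted sa.
have amin : forall m, m \in mu -> a < m by apply/allP/(order_path_min lt_trans sa).
rewrite big_cons mulrCA; set p1 := g * _ => -[_|i imu].
  rewrite horner_deriv_XsubCM subrr mul0r addr0 /= subSS subn0 /p1 hornerM.
  rewrite mulrCA mulr_gt0 ?g0 ?mem_head // horner_prod.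
  under eq_bigr => m _ do rewrite hornerXsubC.
  exact: prod_sub_sign.
have mi : mu`_i \in mu by rewrite mem_nth.
rewrite /= subSS horner_deriv_XsubCM.
have /rootP-> : root p1 mu`_i by rewrite rootM root_prod_XsubC mi orbT.
rewrite add0r mulrCA mulr_gt0 ?subr_gt0 ?amin //.
by apply: IH => // x xmu; apply: g0; rewrite inE xmu orbT.
Qed.

Lemma monic_gt0_rhp g x : g \is monic ->
  (forall z, croot g z -> complex.Re z < 0) -> 0 <= x -> 0 < g.[x].
Proof.
move=> mg gz x0; have nr : {in `[0, +oo[, forall y, ~~ root g y}.
  move=> y /[!in_itv] /= /[!andbT] y0; apply: contraTN y0.
  by rewrite -croot_real => /gz /=; rewrite -ltNge.
have xI : x \in `[0, +oo[ by rewrite in_itv /= x0.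
have := sgp_pinftyP nr xI; rewrite /sgp_pinfty (monicP mg) sgr1.
by move/eqP; rewrite sgr_cp0.
Qed.

Lemma mup_eq1 p x : p != 0 -> (mup x p == 1%N) = root p x && (p^`().[x] != 0).
Proof.
move=> p0; have [px|npx] := boolP (root p x); last by rewrite mupNroot.
have /factor_theorem[q pq] := px.
have q0 : q != 0 by apply: contraNneq p0 => q0; rewrite pq q0 mul0r.
rewrite pq mupM ?polyXsubC_eq0 // (@mup_XsubCX _ 1) eqxx addn1 eqSS.
rewrite mulrC horner_deriv_XsubCM subrr mul0r addr0.
by rewrite eqn0Ngt -XsubC_dvd // dvdp_XsubCl.
Qed.

Lemma nb_zeros_mulX p (I : interval R) : p != 0 -> 0 \notin I ->
  nb_zeros ('X * p) I = nb_zeros p I.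
Proof.
move=> p0 I0; rewrite nb_zerosM ?polyX_eq0 //.
by rewrite -[X in nb_zeros X I]subr0 -polyC0 nb_zeros_XsubC (negbTE I0).
Qed.

(** Moves an alternating sign pattern one index down: once the sign of [x] is known, a sign change
    fixes that of [y]. *)
Lemma signed_mul_lt0 (k i : nat) x y : (i < k)%N ->
  0 < (-1) ^+ (k - i.+1) * x -> (x * y < 0) = (0 < (-1) ^+ (k - i) * y).
Proof.
move=> ik; rewrite -(subnSK ik) exprS; set e := _ ^+ _ => ex.
have <- : (e * x) * (e * y) = x * y.
  by rewrite mulrACA -expr2 /e sqrr_sign mul1r.
by rewrite pmulr_rlt0 // mulN1r mulNr oppr_gt0.
Qed.

(** [0 :: mu] is the list of zeros of $Xp$ in the closed right half-plane. The parity conditions on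
    the negative zeros of $Xp$ become these alternating signs, ending with a positive value at the
    leftmost point. *)
Definition alternating_at p mu := forall i, (i <= size mu)%N ->
  0 < (-1) ^+ (size mu - i) * p.[- (0 :: mu)`_i].

Lemma rhp_signs p mu : p \is monic -> sorted <%R mu ->
  (forall x, x \in mu -> 0 < x) ->
  (forall z, croot p z /\ 0 <= complex.Re z <->
     (exists2 x, x \in mu & z = x%:C)) ->
  (forall x, x \in mu -> p^`().[x] != 0) ->
  0 < (-1) ^+ size mu * p.[0] /\
  forall i, (i < size mu)%N ->
    0 < (-1) ^+ (size mu - i.+1) * p^`().[mu`_i].
Proof.
move=> mp smu mu0 muP dmu.
have [g pg gz] := simple_rhp_factor (lt_sorted_uniq smu) muP dmu.
have mg : g \is monic by rewrite -(monicMr g (monic_prod_XsubC mu xpredT id)) -pg.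
have g0 x : 0 <= x -> 0 < g.[x] by exact: monic_gt0_rhp.
rewrite pg; split.
  rewrite hornerM mulrCA mulr_gt0 ?g0 // horner_prod.
  under eq_bigr => m _ do rewrite hornerXsubC.
  exact: prod_sub_sign.
by apply: sorted_deriv_sign => // x /mu0/ltW; exact: g0.
Qed.

(** The signs of $p'(\mu_i)$ alternate, and [rhp_sign] transfers them to $p(-\mu_i)$. *)
Lemma rhp_pattern_alternating p mu : p \is monic -> rhp_pattern p mu ->
  alternating_at p mu.
Proof.
move=> mp H.
have [p0 dp] := rhp_signs mp (rhp_sorted H) (@rhp_gt0 _ _ _ H) (rhp_roots H)
  (fun x => @rhp_deriv_neq0 _ _ _ x H).
move=> [|i] imu; first by rewrite subn0 oppr0.
have mi : mu`_i \in mu by rewrite mem_nth.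
have := mulr_gt0 (dp i imu) (rhp_sign H mi).
rewrite -mulrA (mulrA p^`().[_]) -expr2 mulrCA pmulr_rgt0 //.
by rewrite exprn_even_gt0 //= (rhp_deriv_neq0 H).
Qed.

Lemma croot_mulX p z : croot ('X * p) z = (z == 0) || croot p z.
Proof. by rewrite crootM /croot map_polyX rootX. Qed.

Lemma size_mulX_l p : p != 0 -> size ('X * p) = (size p).+1.
Proof. by move=> p0; rewrite mulrC size_mulX. Qed.

Lemma almost_genHurwitzI_rhp_pattern p k : p \is monic -> ~~ odd (size p).-1 ->
  almost_genHurwitzI_order p k -> exists2 mu, size mu = k & rhp_pattern p mu.
Proof.
move=> mp ep [mu0 smu0 H]; have p0 := monic_neq0 mp.
case: mu0 smu0 H => // a mu [smu] H; exists mu => //.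
have memP x : x \in a :: mu = (0 <= x) && ((x == 0) || root p x).
  apply/idP/andP => [xmu|[x0 px]].
    have [] := (ghI_closed_rhp H x%:C).2 (ex_intro2 _ _ x xmu erefl).
    by rewrite -/(croot _ _) croot_mulX croot_real fmorph_eq0 => -> ->.
  have [|y ymu [->] //] := (ghI_closed_rhp H x%:C).1.
  by rewrite -/(croot _ _) croot_mulX croot_real fmorph_eq0.
have amin : forall m, m \in mu -> a < m.
  by apply/allP/(order_path_min lt_trans (ghI_sorted H)).
(* $0$ is a zero of $Xp$, so it is in the list, whose entries are nonnegative; the least entry is
   thus $0$. *)
have a0 : a = 0.
  have a0 : 0 <= a by have := mem_head a mu; rewrite memP => /andP[].
  have : 0 \in a :: mu by rewrite memP lexx eqxx.
  by rewrite inE => /predU1P[//|/amin]; rewrite ltNge a0.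
rewrite {}a0 in H memP amin.
have mup0 x : x \in mu -> mup x p = 1%N.
  move=> xmu; have x0 := amin _ xmu; rewrite -(ghI_simple H (_ : x \in 0 :: mu)).
    by rewrite mupMr // rootX gt_eqF.
  by rewrite inE xmu orbT.
have p00 : p.[0] != 0.
  have := ghI_simple H (mem_head 0 mu).
  rewrite mupM ?polyX_eq0 // -[X in mup _ X]subr0 -polyC0 (@mup_XsubCX _ 1) eqxx.
  rewrite add1n => -[] /eqP; rewrite -leqn0 leqNgt -XsubC_dvd // dvdp_XsubCl.
  by [].
have dp x : x \in mu -> p^`().[x] != 0.
  by move=> /mup0/eqP; rewrite mup_eq1 // => /andP[].
have muP z : croot p z /\ 0 <= complex.Re z <-> exists2 x, x \in mu & z = x%:C.
  split=> [[pz Rz]|[x xmu ->]].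
    have [|x xmu zx] := (ghI_closed_rhp H z).1.
      by rewrite -/(croot _ _) croot_mulX pz orbT.
    exists x => //; move: xmu; rewrite inE => /predU1P[x0|//].
    by move: pz; rewrite zx x0 croot_real /root (negbTE p00).
  have := memP x; rewrite inE xmu orbT croot_real (gt_eqF (amin _ xmu)) /=.
  by move=> /esym/andP[].
have smu' : sorted <%R mu := path_sorted (ghI_sorted H).
have [sp0 sdp] := rhp_signs mp smu' amin muP dp.
have alt : alternating_at p mu.
  have pN0 i : (i <= size mu)%N -> p.[- (0 :: mu)`_i] != 0.
    case: i => [|i] imu; first by rewrite oppr0.
    have := ghI_opp H (i := i.+1); rewrite /= ltnS imu => /(_ isT).
    by rewrite hornerM mulf_eq0 negb_or => /andP[].
  have nneg i : (i <= size mu)%N -> 0 <= (0 :: mu)`_i.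
    by move=> imu; have := @mem_nth _ 0 (0 :: mu) i imu; rewrite memP => /andP[].
  (* Induction from the leftmost point inwards. $Xp$ has odd degree, so [ghI_outer] gives an even
     number of zeros beyond that point and $p>0$ there; each interval of [ghI_between] then flips
     the sign. *)
  suff alt d : (d <= size mu)%N ->
      0 < (-1) ^+ (size mu - (size mu - d)) * p.[- (0 :: mu)`_(size mu - d)].
    by move=> i imu; rewrite -(subKn imu); apply: alt; rewrite leq_subr.
  elim: d => [_|d IH dmu].
    rewrite subn0 subnn mul1r; have := ghI_outer H.
    rewrite size_mulX_l //= nb_zeros_mulX //; last first.
      by rewrite in_itv /= -leNgt oppr_le0 nneg.
    rewrite odd_nb_zeros_ninfty ?pN0 // -signr_odd (negbTE ep) expr0 mul1r.
    move: ep; rewrite (polySpred p0) /= => -> /= /negbT.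
    by rewrite -leNgt le_eqVlt eq_sym (negbTE (pN0 _ _)).
  have lt_i : (size mu - d.+1 < size mu)%N by move: dmu; clear; lia.
  have eS : (size mu - d)%N = (size mu - d.+1).+1 by rewrite subnSK.
  have := IH (ltnW dmu); rewrite eS => h; rewrite -(signed_mul_lt0 _ lt_i h).
  have := ghI_between H (i := (size mu - d.+1)%N); rewrite [size _]/= ltnS.
  move=> /(_ lt_i); rewrite nb_zeros_mulX //; last first.
    by rewrite in_itv /= [X in _ && X]ltNge oppr_le0 nneg ?andbF // leq_subr.
  rewrite odd_nb_zeros_oo ?pN0 ?(ltnW lt_i) //.
  by rewrite ltrN2 (lt_sorted_ltn_nth 0 (ghI_sorted H)) ?inE /= ?ltnS // ltnW.
split=> // x xmu; have imu : (index x mu < size mu)%N by rewrite index_mem.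
have := mulr_gt0 (sdp _ imu) (alt (index x mu).+1 imu).
rewrite /= nth_index // mulrACA -expr2 pmulr_rgt0 //.
by rewrite exprn_even_gt0 //= signr_eq0.
Qed.

Lemma rhp_pattern_almost_genHurwitzI p l mu :
  p \is monic -> size p = (2 * l).+1 -> (size mu <= l)%N ->
  rhp_pattern p mu -> almost_genHurwitzI_order p (size mu).
Proof.
move=> mp sp mul H; exists (0 :: mu) => //; have p0 := monic_neq0 mp.
have alt := rhp_pattern_alternating mp H.
have pN0 i : (i <= size mu)%N -> p.[- (0 :: mu)`_i] != 0.
  by move=> /alt; apply: contraTneq => ->; rewrite mulr0 ltxx.
have p00 : p.[0] != 0 by have := pN0 0%N isT; rewrite oppr0.
have s0 : sorted <%R (0 :: mu).
  by rewrite /= path_min_sorted ?(rhp_sorted H) //; apply/allP => x /(rhp_gt0 H).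
have nneg i : (i <= size mu)%N -> 0 <= (0 :: mu)`_i.
  move=> imu; have := @mem_nth _ 0 (0 :: mu) i imu.
  by rewrite inE => /predU1P[->|/(rhp_gt0 H)/ltW].
have muP z : croot ('X * p) z /\ 0 <= complex.Re z <->
    exists2 x, x \in 0 :: mu & z = x%:C.
  rewrite croot_mulX; split=> [[/predU1P[->|pz] Rz]|[x]].
  - by exists 0; rewrite ?mem_head.
  - have [x xmu ->] := (rhp_roots H z).1 (conj pz Rz).
    by exists x; rewrite // inE xmu orbT.
  rewrite inE => /predU1P[->|xmu] ->; first by rewrite eqxx lexx.
  have [-> ->] := (rhp_roots H x%:C).2 (ex_intro2 _ _ x xmu erefl).
  by rewrite orbT.
split=> //.
(* $Xp$ has degree $2l+1$, so its order may be as large as $l+1$, while [0 :: mu] has one entry more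
   than [mu]. *)
- rewrite size_mulX_l //= sp addn1 /= ltnS; lia.
- by apply/allP => x; rewrite inE => /predU1P[->|/(rhp_gt0 H)/ltW].
- move=> x; rewrite inE => /predU1P[->|xmu].
    rewrite mupM ?polyX_eq0 // -[X in (mup _ X + _)%N]subr0 -polyC0.
    rewrite (@mup_XsubCX _ 1) eqxx.
    by rewrite mupNroot.
  rewrite mupMr ?rootX ?gt_eqF ?(rhp_gt0 H) //; apply/eqP; rewrite mup_eq1 //.
  by rewrite (rhp_deriv_neq0 H) // andbT; apply/rootP/(rhp_root H).
- move=> [|i] // /andP[_ imu]; rewrite hornerM mulf_neq0 ?pN0 //.
  by rewrite hornerX oppr_eq0 gt_eqF //= (rhp_gt0 H) ?mem_nth.
- by rewrite ltxx.
- move=> i; rewrite [size _]/= ltnS => imu; have imu' := ltnW imu.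
  rewrite nb_zeros_mulX //; last first.
    by rewrite in_itv /= [X in _ && X]ltNge oppr_le0 nneg ?andbF.
  rewrite odd_nb_zeros_oo ?pN0 //; last first.
    by rewrite ltrN2 (lt_sorted_ltn_nth 0 s0) ?inE /= ?ltnS.
  by rewrite (signed_mul_lt0 _ imu (alt _ imu)) alt.
- by rewrite oppr0 nb_zeros_noroot // => x; rewrite in_itv /= lt_asym.
- rewrite size_mulX_l // sp /= nb_zeros_mulX //; last first.
    by rewrite in_itv /= -leNgt oppr_le0 (nneg (size mu)).
  rewrite odd_nb_zeros_ninfty ?(pN0 (size mu)) // sp /= exprM sqrrN.
  rewrite expr1n expr1n mul1r.
  have := alt _ (leqnn (size mu)); rewrite subnn mul1r => /lt_gtF ->.
  by rewrite mul2n odd_double.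
- move=> z pz Iz; rewrite ltNge; apply: contra Iz => Rz.
  by have [x _ ->] := (muP z).1 (conj pz Rz).
Qed.

End GenHurwitz.

(** * Schwarz matrices *)

Section SchwarzMatrix.
Variable R : rcfType.
Variable l : nat.
Hypothesis l0 : (0 < l)%N.
Implicit Types b : (2 * l).-tuple R.

(* The polynomials schwarz_poly are indexed from the last row upwards. *)
Definition rev_entries b (i : nat) : R := b`_(2 * l - i.+1).

Let n0 : (0 < 2 * l)%N. Proof. by rewrite muln_gt0. Qed.
Let en : ~~ odd (2 * l). Proof. by rewrite mul2n odd_double. Qed.

Lemma char_poly_schwarz b :
  char_poly (schwarz_mx b) = schwarz_char (rev_entries b) (2 * l).
Proof. by apply: char_poly_schwarz_mx => //; lia. Qed.

Lemma rev_entries_neq0 b : (forall k, (k < 2 * l)%N -> b`_k != 0) ->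
  forall i, (i < 2 * l)%N -> rev_entries b i != 0.
Proof. by move=> b0 i i_l; apply: b0; lia. Qed.

Lemma schwarz_weight_entries b i : (i <= 2 * l)%N ->
  schwarz_weight (rev_entries b) (2 * l) i =
    2 * \prod_(0 <= k < 2 * l - i) b`_k.
Proof.
move=> il; rewrite /schwarz_weight big_nat_rev /= -{1}(add0n i) big_addn.
congr (_ * _); apply: eq_big_nat => j jl; rewrite /rev_entries.
by congr (_`_ _); lia.
Qed.

Lemma prod_pairs b t :
  \prod_(0 <= k < 2 * t.+1) b`_k =
    (\prod_(0 <= k < 2 * t) b`_k) * (b`_(2 * t) * b`_(2 * t).+1).
Proof. by rewrite mulnS !big_nat_recr //= mulrA. Qed.

(** A weight of even index is twice a product of initial pairs $b_{2j}b_{2j+1}$; conversely each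
    pair is a quotient of two consecutive such products. *)
Lemma pairs_positiveE b : pairs_positive b <->
  (forall i, (i < 2 * l)%N -> ~~ odd i ->
     0 < schwarz_weight (rev_entries b) (2 * l) i).
Proof.
split=> [bp i il oi|w j jl].
  rewrite schwarz_weight_entries 1?ltnW // pmulr_rgt0 //.
  have [t [tl ->]] : exists t, (t <= l)%N /\ (2 * l - i)%N = (2 * t)%N.
    by exists (l - i./2)%N; have := odd_double_half i; rewrite (negbTE oi); lia.
  elim: t tl => [_|t IH tl]; first by rewrite muln0 big_geq.
  by rewrite prod_pairs mulr_gt0 ?bp // IH // ltnW.
have pos t : (t <= l)%N -> 0 < \prod_(0 <= k < 2 * t) b`_k.
  case: t => [_|t tl]; first by rewrite muln0 big_geq.
  have := w (2 * l - 2 * t.+1)%N; rewrite schwarz_weight_entries ?leq_subr //.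
  rewrite pmulr_rgt0 // (_ : (2 * l - (2 * l - 2 * t.+1))%N = (2 * t.+1)%N).
    2: by lia.
  by apply; [lia|rewrite -mulnBr mul2n odd_double].
by have := pos j.+1 jl; rewrite prod_pairs (pmulr_rgt0 _ (pos j (ltnW jl))).
Qed.

Lemma nb_neg_productsE b : nb_neg_products b =
  #|[set i : 'I_(2 * l) | odd i &
      (schwarz_weight (rev_entries b) (2 * l) i < 0)%R]|.
Proof.
(* The product $b_0\cdots b_{2i}$ has $2i+1$ factors, so it belongs to the weight of index
   $2l-(2i+1)$; these are exactly the odd indices. *)
have lt_f (i : 'I_l) : (2 * l - (2 * i).+1 < 2 * l)%N by lia.
pose f (i : 'I_l) := Ordinal (lt_f i).
have f_inj : injective f.
  move=> i j /(congr1 val) /= ij; apply: val_inj => /=.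
  by have := ltn_ord i; have := ltn_ord j; lia.
rewrite /nb_neg_products -(card_imset _ f_inj); apply: eq_card => i.
have prodE (j : 'I_l) : schwarz_weight (rev_entries b) (2 * l) (f j) =
    2 * \prod_(0 <= k < (2 * j).+1) b`_k.
  rewrite schwarz_weight_entries /= ?leq_subr //; congr (2 * \prod_(0 <= k < _) _).
  by have := ltn_ord j; lia.
apply/imsetP/idP => [[j]|].
  rewrite !inE => jneg ->; rewrite prodE pmulr_rlt0 // jneg andbT /=.
  by rewrite oddB ?mul2n ?odd_double //= ?odd_double //; have := ltn_ord j; lia.
rewrite inE => /andP[oi ineg].
have lt_j : ((2 * l - i.+1)./2 < l)%N by have := ltn_ord i; lia.
have ifj : i = f (Ordinal lt_j).
  apply: val_inj => /=; have := ltn_ord i; have := odd_double_half i; rewrite oi.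
  lia.
exists (Ordinal lt_j) => //; rewrite inE.
by move: ineg; rewrite {1}ifj prodE pmulr_rlt0.
Qed.

Lemma schwarz_rhp_pattern b mu : (forall k, (k < 2 * l)%N -> b`_k != 0) ->
  rhp_pattern (char_poly (schwarz_mx b)) mu ->
  pairs_positive b /\ nb_neg_products b = size mu.
Proof.
move=> b0; rewrite char_poly_schwarz => H.
have [w neg] := rhp_pattern_weights n0 en H (rev_entries_neq0 b0).
by split; [apply/pairs_positiveE|rewrite nb_neg_productsE].
Qed.

Lemma nb_neg_products_leq b : (nb_neg_products b <= l)%N.
Proof. by rewrite -[X in (_ <= X)%N]card_ord; apply: max_card. Qed.

Lemma pairs_positive_almost_genHurwitzI b :
  (forall k, (k < 2 * l)%N -> b`_k != 0) -> pairs_positive b ->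
  almost_genHurwitzI (char_poly (schwarz_mx b)).
Proof.
move=> b0 /pairs_positiveE w.
have [mu H] := schwarz_char_rhp_pattern n0 en (rev_entries_neq0 b0) w.
rewrite -char_poly_schwarz in H; exists (size mu).
have [_ sz] := schwarz_rhp_pattern b0 H.
(* The order bound comes from rewriting [size mu] as a count over ['I_l]. *)
apply: (@rhp_pattern_almost_genHurwitzI _ _ l) H;
  rewrite -?sz ?nb_neg_products_leq //.
  exact: char_poly_monic.
exact: size_char_poly.
Qed.

Lemma almost_genHurwitzI_order_schwarz b k :
  (forall k, (k < 2 * l)%N -> b`_k != 0) ->
  almost_genHurwitzI_order (char_poly (schwarz_mx b)) k ->
  pairs_positive b /\ k = nb_neg_products b.
Proof.
move=> b0 /almost_genHurwitzI_rhp_pattern[||mu <- H].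
- exact: char_poly_monic.
- by rewrite size_char_poly.
by have [bp ->] := schwarz_rhp_pattern b0 H.
Qed.

Lemma schwarz_mx_inj b b' : (forall k, (k < 2 * l)%N -> b`_k != 0) ->
  char_poly (schwarz_mx b) = char_poly (schwarz_mx b') -> b = b'.
Proof.
move=> b0; rewrite !char_poly_schwarz => e.
apply: eq_from_tnth => i; rewrite !(tnth_nth 0).
have il : (2 * l - i.+1 < 2 * l)%N by lia.
have := schwarz_char_inj (rev_entries_neq0 b0) n0 e il.
by rewrite /rev_entries subnS subKn //= ltn_ord.
Qed.

Lemma schwarz_mx_exists (p : {poly R}) :
  p \is monic -> size p = (2 * l).+1 ->
  (forall j, (1 <= j <= 2 * l)%N -> hurwitz_det p j != 0) ->
  exists2 b : (2 * l).-tuple R, forall k, (k < 2 * l)%N -> b`_k != 0 &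
    char_poly (schwarz_mx b) = p.
Proof.
move=> mp sp H; have [c c0 pc] := schwarz_char_exists n0 mp sp H.
pose b := [tuple c (2 * l - i.+1)%N | i < 2 * l].
have bE k : (k < 2 * l)%N -> b`_k = c (2 * l - k.+1)%N.
  by move=> kl; rewrite -(tnth_nth 0 b (Ordinal kl)) tnth_mktuple.
exists b => [k kl|]; first by rewrite bE // c0 //; lia.
rewrite pc; apply: char_poly_schwarz_mx => [|i il]; first by lia.
by rewrite bE; [congr c|]; lia.
Qed.

End SchwarzMatrix.

(** * Spectra and the two problems *)

Lemma has_spectrumP (R : rcfType) n (J : 'M[R]_n) (lambda : n.-tuple R[i]) :
  has_spectrum J lambda <->
  map_poly (real_complex R) (char_poly J) = \prod_(z <- lambda) ('X - z%:P).
Proof.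
rewrite /has_spectrum map_char_poly; set q := char_poly _.
have mq : q \is monic by exact: char_poly_monic.
split=> [h|-> z]; last by rewrite mu_prod_XsubC.
have [r qr] := closed_field_poly_normal q.
rewrite (monicP mq) scale1r in qr; rewrite qr; apply: perm_big.
by apply/allP => z _ /=; rewrite -h qr mu_prod_XsubC.
Qed.


Theorem theorem5p3 (R : realType) (l : nat) (hl : (1 <= l)%N) :
  (forall b : (2 * l).-tuple R,
     (forall k, (k < 2 * l)%N -> b`_k != 0) ->
     (almost_genHurwitzI (char_poly (schwarz_mx b)) <-> pairs_positive b) /\
     (forall kappa : nat,
        almost_genHurwitzI_order (char_poly (schwarz_mx b)) kappa ->
        kappa = nb_neg_products b)) /\
  (forall (lambda : (2 * l).-tuple R[i]) (p : {poly R}) (kappa : nat),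
     map_poly (real_complex R) p = \prod_(z <- lambda) ('X - z%:P) ->
     almost_genHurwitzI_order p kappa ->
     (forall j, (1 <= j <= 2 * l)%N -> hurwitz_det p j != 0) ->
     exists! J : 'M[R]_(2 * l), exists b : (2 * l).-tuple R,
       [/\ J = schwarz_mx b,
           (forall k, (k < 2 * l)%N -> b`_k != 0),
           pairs_positive b,
           nb_neg_products b = kappa
         & has_spectrum J lambda]).

Proof.
split=> [b b0|lambda p kappa plambda pk Hdet].
  split=> [|kappa /(almost_genHurwitzI_order_schwarz hl b0)[]] //.
  split=> [[k /(almost_genHurwitzI_order_schwarz hl b0)[]]|] //.
  exact: pairs_positive_almost_genHurwitzI.
have mp : p \is monic.
  by rewrite -(map_monic (real_complex R)) plambda monic_prod_XsubC.
have sp : size p = (2 * l).+1.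
  by rewrite -(size_map_poly (real_complex R)) plambda size_prod_XsubC size_tuple.
(* The Routh scheme gives a matrix with characteristic polynomial $p$; its signs and its number of
   negative products then follow from the direct problem. *)
have [b b0 bp] := schwarz_mx_exists hl mp sp Hdet.
move: pk; rewrite -bp => /(almost_genHurwitzI_order_schwarz hl b0)[bpos ->].
exists (schwarz_mx b); split.
  by exists b; split => //; apply/has_spectrumP; rewrite bp.
(* Uniqueness: the spectrum determines the characteristic polynomial, first over the complex numbers
   and then over [R], and that polynomial determines the entries. *)
move=> _ [b' [-> b'0 _ _ /has_spectrumP sp']]; congr schwarz_mx.
apply: (schwarz_mx_inj hl b0); rewrite bp.
by apply: (map_poly_inj (real_complex R)); rewrite sp'.
Qed.
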